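(* Assume that under $P$ the environment $\omega=\{\omega_x\}_{x\in\mathbb{Z}}$ is an i.i.d. sequence and that $E_P[\log\rho_0]\in(-\infty,0)$. (1) If $E_P[\rho_0]<1$, then $\mathbb{E}[\mathfrak{R}\mid X_1=1,\ \mathfrak{R}<\infty]<\infty$. (2) If either $E_P[\rho_0]>1$, or both $E_P[\rho_0]=1$ and $E_P[\rho_0\log\rho_0]<\infty$, then $\mathbb{E}[\mathfrak{R}\mid X_1=1,\ \mathfrak{R}<\infty]=\infty$.
   Context: An environment is a sequence $\omega=\{\omega_x\}_{x\in\mathbb{Z}}\in[0,1]^{\mathbb{Z}}$. Given $\omega$, the random walk $\{X_n\}_{n\ge0}$ started at $0$ in the environment $\omega$ is the Markov chain on $\mathbb{Z}$ with $X_0=0$ which jumps from $x$ to $x+1$ with probability $\omega_x$ and from $x$ to $x-1$ with probability $1-\omega_x$. Its law (the quenched law) is denoted $P_\omega$. The environment is random with distribution $P$ (a probability measure on $[0,1]^{\mathbb{Z}}$), with expectation $E_P$. The averaged law of the walk is $\mathbb{P}(\cdot)=E_P[P_\omega(\cdot)]$, with expectation $\mathbb{E}$. Set $\rho_x=\frac{1-\omega_x}{\omega_x}$ for $x\in\mathbb{Z}$. The return time to the starting point is $\mathfrak{R}=\inf\{n\ge1: X_n=X_0\}$, with $\inf\emptyset=\infty$. Conditional expectations given an event $A$ of positive probability have the elementary meaning $\mathbb{E}[\mathfrak{R}\mid A]=\mathbb{E}[\mathfrak{R}\mathbf{1}_A]/\mathbb{P}(A)$. The expectation $E_P[\rho_0]$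 is allowed to be $+\infty$ (in which case $E_P[\rho_0]>1$). *)

(* Defs.v *)
From HB Require Import structures.
From mathcomp Require Import all_boot all_order all_algebra.
From mathcomp Require Import finmap interval_inference.
From mathcomp Require Import all_classical all_reals all_analysis.

Set Implicit Arguments.
Unset Strict Implicit.
Unset Printing Implicit Defensive.

Import Order.TTheory GRing.Theory Num.Theory.
Import numFieldNormedType.Exports.

Local Open Scope classical_set_scope.
Local Open Scope ring_scope.
Local Open Scope ereal_scope.

HB.instance Definition _ := isPointed.Build int 0%R.

HB.instance Definition _ (R : realType) :=
  isPointed.Build {i01 R} (0%:i01)%R.

(* The product sigma-algebras on [0,1]^Z and Z^N are generated by the events
   that constrain a single coordinate. *)
Definition env_cylinders (R : realType) : set (set (int -> {i01 R})) :=
  [set [set w | B (w x)%:num] | x in [set: int]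
                              & B in (measurable : set (set R))].

Definition environment (R : realType) := g_sigma_algebraType (@env_cylinders R).

HB.instance Definition _ (R : realType) := Measurable.on (environment R).

Definition path_cylinders : set (set (nat -> int)) :=
  [set [set X | X n = k] | n in [set: nat] & k in [set: int]].

Definition trajectory := g_sigma_algebraType path_cylinders.

HB.instance Definition _ := Measurable.on trajectory.

Section environment_law.
Context {R : realType}.
Implicit Types (w : environment R) (x y : int).

Definition env_at x w : R := (w x)%:num.

Definition iid_environment (P : probability (environment R) R) :=
  (forall x y (B : set R), measurable B ->
     P (env_at x @^-1` B) = P (env_at y @^-1` B)) /\
  (forall (s : {fset int}) (B : int -> set R),
     (forall x, measurable (B x)) ->
     P (\bigcap_(x in [set` s]) (env_at x @^-1` B x)) =
     \prod_(x <- s) P (env_at x @^-1` B x)).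

(* Division in \bar R satisfies 1 / 0 = +oo, so that rho x w = +oo when
   env_at x w = 0. *)
Definition rho x w : \bar R := (1 - env_at x w)%:E / (env_at x w)%:E.

Definition jump_prob w x y : R :=
  if y == (x + 1)%R then env_at x w
  else if y == (x - 1)%R then (1 - env_at x w)%R
  else 0%R.

(* Q w is the law of the Markov chain started at 0 with transition matrix
   jump_prob w. These identities determine Q w on the cylinders, hence
   everywhere. *)
Definition quenched_law (Q : R.-pker (environment R) ~> trajectory) :=
  forall w,
    Q w [set X : trajectory | X 0%N = 0%R] = 1 /\
    (forall (n : nat) (path : nat -> int) (y : int),
       Q w [set X : trajectory |
              (forall k, (k <= n)%N -> X k = path k) /\ X n.+1 = y] =
       Q w [set X : trajectory | forall k, (k <= n)%N -> X k = path k] *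
       (jump_prob w (path n) y)%:E).

End environment_law.

Section averaged_law.
Context {R : realType}.
Variables (P : probability (environment R) R)
  (Q : R.-pker (environment R) ~> trajectory).

Definition averaged_law (A : set trajectory) : \bar R := \int[P]_w Q w A.

Let averaged_law0 : averaged_law set0 = 0.
Proof. by rewrite /averaged_law integral0_eq// => w _; rewrite measure0. Qed.

Let averaged_law_ge0 A : 0 <= averaged_law A.
Proof. exact: integral_ge0. Qed.

Let averaged_law_sigma_additive : semi_sigma_additive averaged_law.
Proof.
move=> F mF tF mUF; rewrite [X in _ --> X](_ : _ =
  \int[P]_w (\sum_(n <oo) Q w (F n))); last first.
  apply: eq_integral => w _.
  by apply/esym/cvg_lim => //; exact/measure_semi_sigma_additive.
apply/cvg_closeP; split.
  by apply: is_cvg_nneseries => n _ _; exact: integral_ge0.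
by rewrite closeE// integral_nneseries// => n; exact: measurable_kernel.
Qed.

HB.instance Definition _ := isMeasure.Build _ _ _ averaged_law
  averaged_law0 averaged_law_ge0 averaged_law_sigma_additive.

Let averaged_law_setT : averaged_law setT = 1.
Proof.
rewrite /averaged_law (eq_integral (cst 1)); last first.
  by move=> w _; rewrite /= prob_kernel.
by rewrite integral_cst// mul1e; exact: probability_setT.
Qed.

HB.instance Definition _ :=
  Measure_isProbability.Build _ _ _ averaged_law averaged_law_setT.

End averaged_law.

Definition return_time {R : realType} (X : trajectory) : \bar R :=
  ereal_inf [set n%:R%:E | n in [set n : nat | (1 <= n)%N /\ X n = X 0%N]].

Definition cond_expectation d (T : measurableType d) (R : realType)
    (mu : probability T R) (f : T -> \bar R) (A : set T) : \bar R :=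
  (\int[mu]_x (f x * (\1_A x)%:E)) / mu A.

(* Main.v *)
Require Import Defs.
From HB Require Import structures.
From mathcomp Require Import all_boot all_order all_algebra.
From mathcomp Require Import finmap interval_inference.
From mathcomp Require Import all_classical all_reals all_analysis.
From mathcomp Require Import measurable_realfun ring lra zify.

Set Implicit Arguments.
Unset Strict Implicit.
Unset Printing Implicit Defensive.

Import Order.TTheory GRing.Theory Num.Theory.
Import numFieldNormedType.Exports.

Local Open Scope classical_set_scope.
Local Open Scope ring_scope.

(** On the event X_1 = 1 the return time is 1 + T, where T is the time that the
walk needs from 1 to 0, and T depends on the environment to the right of 0
only. Write Pi_x = rho_1 ... rho_x and A_x = Pi_0 + ... + Pi_(x-1). The function
A is harmonic for the walk on the positive half-line and vanishes at 0, and the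
walk is reversible for the weights pi_y = 1 / Pi_(y-1) + 1 / Pi_y. Hence, for a
fixed environment, the mean of T on the event that 0 is visited before N is

  sum over 1 <= y < N of pi_y ((A_N - A_y) / A_N)^2,

which is green_sum, and the mean of T on the event that T is finite is the
supremum of these sums over N (moment_le_green_sum, green_sum_le_moment). The
theorem is thus about the boundedness in N of the expectation of green_sum.
Since A_N = A_x + Pi_x a, where a is A_(N-x) in the environment seen from x, the
x-th summand is comparable to green_term x a = Pi_x a^2 / (A_x + Pi_x a)^2, and
a is independent of Pi_x and A_x.

When rho_0 has mean m < 1, translate the environment by - x before
integrating the x-th summand. The factor a then no longer depends on x, while
A_x / Pi_x becomes a sum b_x with increments 1 / Pi_x, and the summand becomes
a^2 (b_x - b_(x-1)) / (b_x + a)^2. The sum over x telescopes and is at most a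
(sum_green_term_backward), so that the expectation of green_sum is at most
2 (1 + E[A_N]), which is bounded because E[A_N] = 1 + m + ... + m^(N-1).

When m >= 1, the means E[A_M] are unbounded, and it suffices to show that the
expectation of the sum over x of green_term x a is at least a constant times a,
uniformly in a >= 1 (sum_green_term_ge). This holds if, with a probability
bounded below, Pi_x a visits a fixed window [kappa, 1[ while A_x stays bounded.
The maximal ergodic lemma gives an exponential decay Pi_n <= exp (- eta n) for
all n with positive probability (decaying_gt0); A is then bounded and Pi_x a
does pass below 1. An independent copy of the same event bounds the mean number
of x with Pi_x a in a given interval (renewal_bound); combined with the
integrability of log rho_0, this makes a jump over the window unlikely
(overshoots_unlikely). *)

(** * Harmonic functions of a nearest-neighbour walk on the half-line *)

Section Potential.
Context {R : realFieldType}.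
Implicit Types (s : nat -> R) (n x : nat).

Definition rho_prod s n : R := \prod_(i < n) s i.+1.

(** The function that is harmonic for the walk on the positive half-line, with
value 0 at 0 and 1 at 1. *)
Definition scale s n : R := \sum_(j < n) rho_prod s j.

(** Reversing measure of the walk, for the conductance 1 / rho_prod s x of the
edge from x to x + 1. *)
Definition reversible_weight s y : R := (rho_prod s y.-1)^-1 + (rho_prod s y)^-1.

(** Probability that the walk started at x visits 0 before N. *)
Definition hit0 s N x : R := (scale s N - scale s x) / scale s N.

(** Mean of the hitting time of 0 from 1, on the event that 0 is visited before
N. Summing over the positions of the walk gives the sum of G(1, y) hit0 N y,
where the Green function of the walk killed at 0 and at N is, by reversibility
and by decomposing at the last jump from 1 to 0,
G(1, y) = reversible_weight y * hit0 N y. *)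
Definition green_sum s N : R :=
  \sum_(1 <= y < N) reversible_weight s y * hit0 s N y ^+ 2.

Lemma rho_prod0 s : rho_prod s 0 = 1.
Proof. by rewrite /rho_prod big_ord0. Qed.

Lemma rho_prodSr s n : rho_prod s n.+1 = rho_prod s n * s n.+1.
Proof. by rewrite /rho_prod big_ord_recr. Qed.

Lemma rho_prodSl s n : rho_prod s n.+1 = s 1%N * rho_prod (s \o succn) n.
Proof. by rewrite /rho_prod big_ord_recl. Qed.

Lemma scale0 s : scale s 0 = 0.
Proof. by rewrite /scale big_ord0. Qed.

Lemma scaleSr s n : scale s n.+1 = scale s n + rho_prod s n.
Proof. by rewrite /scale big_ord_recr. Qed.

Lemma scale1 s : scale s 1 = 1.
Proof. by rewrite scaleSr scale0 rho_prod0 add0r. Qed.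

Lemma scaleSl s n : scale s n.+1 = 1 + s 1%N * scale (s \o succn) n.
Proof.
rewrite /scale big_ord_recl rho_prod0; congr (_ + _).
by rewrite mulr_sumr; apply: eq_bigr => i _; rewrite rho_prodSl.
Qed.

Lemma rho_prodD s m n :
  rho_prod s (m + n) = rho_prod s m * rho_prod (fun i => s (m + i)%N) n.
Proof.
elim: n => [|n IH]; first by rewrite addn0 rho_prod0 mulr1.
by rewrite addnS !rho_prodSr IH mulrA addnS.
Qed.

Lemma scaleD s m n :
  scale s (m + n) = scale s m + rho_prod s m * scale (fun i => s (m + i)%N) n.
Proof.
elim: n => [|n IH]; first by rewrite addn0 scale0 mulr0 addr0.
by rewrite addnS !scaleSr IH rho_prodD mulrDr addrA.
Qed.

(** Discrete integration by parts: the increment of the left-hand side in x, which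
serves to solve difference equations driven by the weights w. *)
Lemma weighted_scale_sumS s (w : nat -> R) x :
  \sum_(1 <= y < x.+1) w y * (scale s x.+1 - scale s y) =
  \sum_(1 <= y < x) w y * (scale s x - scale s y) +
  rho_prod s x * \sum_(1 <= y < x.+1) w y.
Proof.
case: x => [|x]; first by rewrite !big_geq// mulr0 addr0.
rewrite (big_nat_recr x.+1)//= [in RHS](big_nat_recr x.+1)//= [in RHS]mulrDr addrA.
rewrite [scale s x.+2]scaleSr; congr (_ + _); last by ring.
rewrite mulr_sumr -big_split/=.
by apply: eq_bigr => y _; ring.
Qed.

Section positive.
Variable s : nat -> R.
Hypothesis s_gt0 : forall x, 0 < s x.

Lemma rho_prod_gt0 n : 0 < rho_prod s n.
Proof. by apply: prodr_gt0 => i _. Qed.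

Lemma scale_ge0 n : 0 <= scale s n.
Proof. by apply: sumr_ge0 => i _; exact/ltW/rho_prod_gt0. Qed.

Lemma le_scale m n : (m <= n)%N -> scale s m <= scale s n.
Proof.
move=> /subnKC <-; elim: (n - m)%N => [|k IH]; first by rewrite addn0.
by rewrite addnS scaleSr (le_trans IH)// lerDl ltW// rho_prod_gt0.
Qed.

Lemma scale_ge1 n : (0 < n)%N -> 1 <= scale s n.
Proof. by move=> n0; rewrite -(scale1 s) le_scale. Qed.

Lemma reversible_weight_gt0 y : 0 < reversible_weight s y.
Proof. by rewrite addr_gt0// invr_gt0 rho_prod_gt0. Qed.

Lemma reversible_weightE y :
  rho_prod s y.+1 * reversible_weight s y.+1 = 1 + s y.+1.
Proof.
rewrite /reversible_weight/= rho_prodSr.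
have := rho_prod_gt0 y; have := s_gt0 y.+1 => h1 h2.
by field; rewrite !gt_eqF.
Qed.

Lemma hit0_ge0 N x : (x <= N)%N -> 0 <= hit0 s N x.
Proof. by move=> xN; rewrite divr_ge0 ?scale_ge0// subr_ge0 le_scale. Qed.

End positive.
End Potential.
Arguments reversible_weight : simpl never.

Section FirstHit.
Context {R : realFieldType}.

(** Probability that the walk with probabilities o of a jump to the right, started
at x, visits 0 for the first time at time n. *)
Fixpoint first_hit (o : nat -> R) (n x : nat) : R :=
  match n, x with
  | 0, _ => (x == 0)%:R
  | n'.+1, 0 => 0
  | n'.+1, x'.+1 => o x * first_hit o n' x.+1 + (1 - o x) * first_hit o n' x'
  end.

Lemma first_hit_ge0 (o : nat -> R) n x :
  (forall i, 0 <= o i <= 1) -> 0 <= first_hit o n x.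
Proof.
move=> o01; elim: n x => [|n IH] [|x] //=.
case/andP: (o01 x.+1) => o0 o1.
by rewrite addr_ge0 ?mulr_ge0 ?IH ?subr_ge0.
Qed.

Lemma eq_first_hit (o o' : nat -> R) n x :
  (forall i, (0 < i)%N -> o i = o' i) -> first_hit o n x = first_hit o' n x.
Proof.
move=> e; elim: n x => [|n IH] [|x] //=.
by rewrite e// !IH.
Qed.

Variables (o s : nat -> R).
Hypothesis o_gt0 : forall x, 0 < o x.
Hypothesis o_lt1 : forall x, o x < 1.
Hypothesis sE : forall x, s x = (1 - o x) / o x.

Let s_gt0 x : 0 < s x.
Proof. by rewrite sE divr_gt0// subr_gt0. Qed.

Let oE x : o x = (1 + s x)^-1.
Proof.
have := o_gt0 x; rewrite sE => h; field.
by rewrite gt_eqF//= addrCA subrr addr0 oner_neq0.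
Qed.

Let o1E x : 1 - o x = s x / (1 + s x).
Proof. by rewrite oE; field; rewrite gt_eqF// addr_gt0. Qed.

Let first_hit_ge0 n x : 0 <= first_hit o n x.
Proof. by apply: first_hit_ge0 => i; rewrite !ltW. Qed.

(** With T the hitting time of 0, mass K x and moment K x are the probability that
T < K and the mean of T on that event, for the walk started at x. *)
Definition mass K x := \sum_(k < K) first_hit o k x.
Definition moment K x := \sum_(k < K) k%:R * first_hit o k x.

Lemma mass_ge0 K x : 0 <= mass K x.
Proof. by apply: sumr_ge0 => k _; exact: first_hit_ge0. Qed.

Lemma moment_ge0 K x : 0 <= moment K x.
Proof. by apply: sumr_ge0 => k _; rewrite mulr_ge0// first_hit_ge0. Qed.

Lemma le_mass K L x : (K <= L)%N -> mass K x <= mass L x.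
Proof.
move=> /subnKC <-; elim: (L - K)%N => [|k IH]; first by rewrite addn0.
by rewrite addnS (le_trans IH)// /mass [leRHS]big_ord_recr/= lerDl first_hit_ge0.
Qed.

Lemma le_moment K L x : (K <= L)%N -> moment K x <= moment L x.
Proof.
move=> /subnKC <-; elim: (L - K)%N => [|k IH]; first by rewrite addn0.
rewrite addnS (le_trans IH)// /moment [leRHS]big_ord_recr/= lerDl.
by rewrite mulr_ge0// first_hit_ge0.
Qed.

Lemma mass0 K : mass K.+1 0 = 1.
Proof. by rewrite /mass big_ord_recl/= big1 ?addr0. Qed.

Lemma moment0 K : moment K 0 = 0.
Proof.
by rewrite /moment big1// => -[[|k] i] _ /=; rewrite ?mul0r ?mulr0.
Qed.

Lemma massS K x :
  mass K.+1 x.+1 = o x.+1 * mass K x.+2 + (1 - o x.+1) * mass K x.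
Proof.
rewrite /mass big_ord_recl/= add0r !mulr_sumr -big_split.
by apply: eq_bigr => k _.
Qed.

Lemma momentS K x :
  moment K.+1 x.+1 =
  o x.+1 * moment K x.+2 + (1 - o x.+1) * moment K x + mass K.+1 x.+1.
Proof.
rewrite massS /moment /mass big_ord_recl/= mul0r add0r.
rewrite !mulr_sumr -!big_split/=.
by apply: eq_bigr => k _; rewrite /bump/= add1n -natr1; ring.
Qed.

(** A walk from x that has less than K <= N - x steps to reach 0 does not meet N. In
terms of equations, hit0 N is harmonic, equals 1 at 0 and is nonnegative on
[0, N], so that the bound propagates along the recursion massS. *)
Lemma mass_le_hit0 N K x : (0 < N)%N -> (x + K <= N)%N -> mass K x <= hit0 s N x.
Proof.
move=> N0; have AN : 0 < scale s N by rewrite (lt_le_trans ltr01)// scale_ge1.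
elim: K x => [|K IH] [|x] xN.
- by rewrite /mass big_ord0 hit0_ge0.
- by rewrite /mass big_ord0 hit0_ge0// -(addn0 x.+1).
- by rewrite mass0 /hit0 scale0 subr0 divff// gt_eqF.
rewrite massS.
have -> : hit0 s N x.+1 = o x.+1 * hit0 s N x.+2 + (1 - o x.+1) * hit0 s N x.
  rewrite o1E oE /hit0 !scaleSr rho_prodSr; field.
  by rewrite gt_eqF//= gt_eqF// addr_gt0.
have o0 := ltW (o_gt0 x.+1); have o1 := o_lt1 x.+1.
by rewrite lerD// ler_wpM2l ?subr_ge0// ?(ltW o1)// IH//; lia.
Qed.

Lemma mass_le1 K x : mass K x <= 1.
Proof.
rewrite (@le_trans _ _ (hit0 s (x + K).+1 x))//.
  by rewrite mass_le_hit0//; lia.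
rewrite ler_pdivrMr ?mul1r ?gerBl ?scale_ge0//.
by rewrite (lt_le_trans ltr01)// scale_ge1.
Qed.

(** The analogue of green_sum for the starting point x: the solution g of
g x = hit0 N x + o x * g (x + 1) + (1 - o x) * g (x - 1) that vanishes at 0 and
at N. *)
Definition occupation N x : R :=
  scale s x * green_sum s N -
  \sum_(1 <= y < x) reversible_weight s y * hit0 s N y * (scale s x - scale s y).

Lemma occupationS N x : occupation N x.+1 - occupation N x =
  rho_prod s x * (green_sum s N -
    \sum_(1 <= y < x.+1) reversible_weight s y * hit0 s N y).
Proof.
rewrite /occupation weighted_scale_sumS scaleSr; ring.
Qed.

(** Both sides obey the same recursion up to its source terms, which mass_le_hit0
compares. The initial inequality is the nonnegativity of occupation N on
[0, N]. *)
Lemma moment_le_occupation N K x :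
  (0 < N)%N -> (x + K <= N)%N -> moment K x <= occupation N x.
Proof.
move=> N0; have AN : 0 < scale s N by rewrite (lt_le_trans ltr01)// scale_ge1.
elim: K x => [|K IH] x xN.
- rewrite /moment big_ord0 /occupation subr_ge0 /green_sum.
  rewrite addn0 in xN.
  case: x xN => [|x] xN; first by rewrite scale0 mul0r big_geq.
  rewrite [in leRHS](big_cat_nat (n:=x.+1))//= mulrDr ler_wpDr//.
    rewrite mulr_ge0 ?scale_ge0// sumr_ge0// => y _.
    by rewrite mulr_ge0 ?sqr_ge0// ltW// reversible_weight_gt0.
  rewrite mulr_sumr ler_sum_nat// => y /andP[y1 yx].
  have yN : (y <= N)%N by lia.
  rewrite [leRHS](_ : _ = reversible_weight s y * hit0 s N y *
    (scale s x.+1 * hit0 s N y)); last by ring.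
  rewrite ler_wpM2l//.
    by rewrite mulr_ge0 ?hit0_ge0// ltW// reversible_weight_gt0.
  rewrite [in leRHS]/hit0 mulrBl divff ?gt_eqF// mulrBr mulr1 lerD2l lerN2.
  rewrite mulrCA ger_pMr ?(lt_le_trans ltr01)// ?scale_ge1//.
  by rewrite ler_pdivrMr// mul1r le_scale.
case: x xN => [|x] xN.
  by rewrite moment0 /occupation scale0 mul0r big_geq// subr0.
rewrite momentS.
have -> : occupation N x.+1 = o x.+1 * occupation N x.+2 +
    (1 - o x.+1) * occupation N x + hit0 s N x.+1.
  have e1 := occupationS N x; have e2 := occupationS N x.+1.
  have -> : occupation N x.+2 = occupation N x.+1 + rho_prod s x.+1 *
     (green_sum s N - \sum_(1 <= y < x.+2) reversible_weight s y * hit0 s N y).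
    by rewrite -e2 addrC subrK.
  have -> : occupation N x = occupation N x.+1 - rho_prod s x * (green_sum s N -
    \sum_(1 <= y < x.+1) reversible_weight s y * hit0 s N y).
    by rewrite -e1; ring.
  rewrite (big_nat_recr x.+1)//=.
  rewrite o1E oE opprD addrA mulrBr.
  rewrite (mulrA (rho_prod s x.+1)) reversible_weightE//.
  rewrite rho_prodSr; field.
  by rewrite gt_eqF// addr_gt0.
have o0 := ltW (o_gt0 x.+1); have o1 := o_lt1 x.+1.
by rewrite lerD ?mass_le_hit0// lerD// ler_wpM2l ?subr_ge0// ?(ltW o1)// IH//; lia.
Qed.

Lemma moment_le_green_sum K : moment K 1 <= green_sum s K.+1.
Proof.
have := @moment_le_occupation K.+1 K 1 isT.
by rewrite add1n leqnn => /(_ isT); rewrite /occupation scale1 mul1r big_geq// subr0.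
Qed.

End FirstHit.

Section GreenLowerBound.
Context {R : realType}.
Variables (o s : nat -> R).
Hypothesis o_gt0 : forall x, 0 < o x.
Hypothesis o_lt1 : forall x, o x < 1.
Hypothesis sE : forall x, s x = (1 - o x) / o x.

Let s_gt0 x : 0 < s x.
Proof. by rewrite sE divr_gt0// subr_gt0. Qed.

(** If the truncated means from 1 are bounded, they converge at every starting
point to a nonnegative solution G of the recursion, with source term the
limiting hitting probability H. The equations determine H and G from H 1 and
G 1. That H is nonnegative at N gives hit0 N <= H, and that G is nonnegative at
N then bounds G 1 from below by green_sum. *)
Lemma green_sum_le_moment (C : R) N :
  (forall K, moment o K 1 <= C) -> (0 < N)%N -> green_sum s N <= C.
Proof.
move=> hC N0.
have s1E x : 1 + s x = (o x)^-1.
  have := o_gt0 x; rewrite sE => h; field; by rewrite gt_eqF.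
have moment_bd x : exists B, forall K, moment o K x <= B.
  suff [] : (exists B, forall K, moment o K x <= B) /\
    (exists B, forall K, moment o K x.+1 <= B) by [].
  elim: x => [|x [[B hB] [B' hB']]].
    by split; [exists 0 => K; rewrite moment0|exists C].
  split; first by exists B'.
  exists (B' / o x.+1) => K; rewrite ler_pdivlMr// mulrC.
  rewrite (le_trans _ (hB' K.+1))// momentS -addrA lerDl.
  by rewrite addr_ge0 ?mass_ge0// mulr_ge0 ?subr_ge0 ?(ltW (o_lt1 _))// moment_ge0.
pose H x := limn (fun K => mass o K x).
pose G x := limn (fun K => moment o K x).
have cH x : mass o K x @[K --> \oo] --> H x.
  apply: nondecreasing_is_cvgn; first by move=> m n; exact: le_mass.
  by exists 1 => _ [K _ <-]; exact: (mass_le1 (s := s)).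
have cG x : moment o K x @[K --> \oo] --> G x.
  apply: nondecreasing_is_cvgn; first by move=> m n; exact: le_moment.
  by have [B hB] := moment_bd x; exists B => _ [K _ <-].
have cHS x : mass o K.+1 x @[K --> \oo] --> H x by rewrite (cvg_shiftS (mass o ^~ x)).
have cGS x : moment o K.+1 x @[K --> \oo] --> G x by rewrite (cvg_shiftS (moment o ^~ x)).
have H0 : H 0 = 1.
  have := cHS 0%N; under eq_cvg do rewrite mass0.
  by move=> h; exact: (cvg_unique _ h (cvg_cst _)).
have G0 : G 0 = 0.
  have := cG 0%N; under eq_cvg do rewrite moment0.
  by move=> h; exact: (cvg_unique _ h (cvg_cst _)).
have HS x : H x.+1 = o x.+1 * H x.+2 + (1 - o x.+1) * H x.
  have := cHS x.+1; under eq_cvg do rewrite massS.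
  move=> h; apply: (cvg_unique _ h) => //.
  by apply: cvgD; apply: cvgMl_tmp.
have GS x : G x.+1 = o x.+1 * G x.+2 + (1 - o x.+1) * G x + H x.+1.
  have := cGS x.+1; under eq_cvg do rewrite momentS.
  move=> h; apply: (cvg_unique _ h) => //.
  by apply: cvgD => //; apply: cvgD; apply: cvgMl_tmp.
have H_ge0 x : 0 <= H x.
  by apply: limr_ge; [exact: cH|near=> n; exact: mass_ge0].
have G_ge0 x : 0 <= G x.
  by apply: limr_ge; [exact: cG|near=> n; exact: moment_ge0].
have G1C : G 1 <= C.
  by apply: limr_le; [exact: cG|near=> n; exact: hC].
pose d := 1 - H 1.
have HE x : H x = 1 - d * scale s x.
  suff [] : H x = 1 - d * scale s x /\ H x.+1 = 1 - d * scale s x.+1 by [].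
  elim: x => [|x [IH1 IH2]].
    by rewrite H0 scale0 scale1 mulr0 mulr1 subr0 /d subKr.
  split=> //.
  have := HS x; rewrite IH1 IH2 => e.
  have o0 := o_gt0 x.+1.
  apply: (mulfI (lt0r_neq0 o0)).
  apply/eqP; rewrite eq_sym -subr_eq0; apply/eqP.
  move/eqP : e; rewrite -subr_eq0 => /eqP e.
  rewrite !scaleSr rho_prodSr sE in e *.
  have o1 : o x.+1 != 0 by rewrite gt_eqF.
  rewrite -[RHS]e; field.
  by rewrite o1.
pose w y := reversible_weight s y * H y.
have DE x : G x.+1 - G x = rho_prod s x * (G 1 - \sum_(1 <= y < x.+1) w y).
  elim: x => [|x IH]; first by rewrite G0 rho_prod0 big_geq// !subr0 mul1r.
  rewrite big_nat_recr//= [RHS](_ : _ =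
    s x.+1 * (G x.+1 - G x) - (1 + s x.+1) * H x.+1); last first.
    by rewrite IH /w -reversible_weightE// rho_prodSr; ring.
  have := GS x; have := o_gt0 x.+1; rewrite s1E sE => o0 e.
  have o1 : o x.+1 != 0 by rewrite gt_eqF.
  rewrite [in RHS]e; apply: (mulfI o1); rewrite [in LHS]e; field.
  by rewrite o1.
have GE x : G x = G 1 * scale s x - \sum_(1 <= y < x) w y * (scale s x - scale s y).
  elim: x => [|x IH]; first by rewrite G0 scale0 mulr0 big_geq// subr0.
  by rewrite -[LHS](subrK (G x)) DE {}IH weighted_scale_sumS scaleSr; ring.
have AN : 0 < scale s N by rewrite (lt_le_trans ltr01)// scale_ge1.
have hH x : hit0 s N x <= H x.
  rewrite HE /hit0 mulrBl divff ?gt_eqF// lerD2l lerN2 mulrC.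
  rewrite ler_wpM2l ?scale_ge0//.
  by have := H_ge0 N; rewrite HE subr_ge0 -ler_pdivlMr// mul1r.
apply: le_trans G1C.
have := G_ge0 N; rewrite GE subr_ge0 -ler_pdivrMr//; apply: le_trans.
rewrite mulr_suml; apply: ler_sum_nat => y /andP[y1 yN].
rewrite /w -[leRHS]mulrA -/(hit0 s N y) expr2 [leLHS]mulrA.
by rewrite ler_wpM2r ?hit0_ge0 1?ltnW// ler_wpM2l// ltW// reversible_weight_gt0.
Unshelve. all: by end_near.
Qed.

End GreenLowerBound.

(** * Summands of the mean hitting time *)

Section GreenTerms.
Context {R : realType}.
Variable s : nat -> R.
Hypothesis s_gt0 : forall x, 0 < s x.

(** The summand of green_sum at x, as a function of the value a at N - x of the
scale function of the sequence seen from x; see hit0_green_term. *)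
Definition green_term (t : nat -> R) x a : R :=
  rho_prod t x * a ^+ 2 / (scale t x + rho_prod t x * a) ^+ 2.

Let tail x := fun i => s (x + i)%N.

Lemma green_term_ge0 x a : 0 <= green_term s x a.
Proof. by rewrite divr_ge0 ?sqr_ge0// mulr_ge0 ?sqr_ge0// ltW// rho_prod_gt0. Qed.

Lemma le_green_term x a b : 0 <= a -> a <= b -> green_term s x a <= green_term s x b.
Proof.
move=> a0 ab; case: x => [|x].
  rewrite /green_term scale0 rho_prod0 !add0r !mul1r.
  have [->|an0] := eqVneq a 0; first by rewrite expr0n/= mul0r divr_ge0// sqr_ge0.
  have {an0}a0 : 0 < a by rewrite lt_neqAle eq_sym an0.
  by rewrite !divff// expf_neq0// gt_eqF// (lt_le_trans a0).
have A0 : 0 < scale s x.+1 by rewrite (lt_le_trans ltr01)// scale_ge1.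
have P0 : 0 < rho_prod s x.+1 by exact: rho_prod_gt0.
have da : 0 < scale s x.+1 + rho_prod s x.+1 * a.
  by rewrite ltr_pwDl// mulr_ge0// ltW.
have b0 := le_trans a0 ab.
have db : 0 < scale s x.+1 + rho_prod s x.+1 * b.
  by rewrite ltr_pwDl// mulr_ge0// ltW.
have E c : green_term s x.+1 c =
    rho_prod s x.+1 * (c / (scale s x.+1 + rho_prod s x.+1 * c)) ^+ 2.
  by rewrite /green_term expr_div_n [RHS]mulrA.
rewrite !E ler_wpM2l ?(ltW P0)//.
rewrite ler_sqr ?nnegrE ?divr_ge0 ?(ltW da) ?(ltW db)//.
rewrite ler_pdivrMr// mulrAC ler_pdivlMr// !mulrDr lerD//.
  by rewrite ler_wpM2r// (ltW A0).
by rewrite mulrCA [leRHS]mulrCA ler_wpM2l ?(ltW P0)// mulrC.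
Qed.

Lemma hit0_green_term N x : (x <= N)%N -> (0 < N)%N ->
  (rho_prod s x)^-1 * hit0 s N x ^+ 2 = green_term s x (scale (tail x) (N - x)).
Proof.
move=> xN N0; have AN : 0 < scale s N by rewrite (lt_le_trans ltr01)// scale_ge1.
have := scaleD s x (N - x); rewrite subnKC// -/(tail x) => e.
rewrite /green_term -e /hit0 [in LHS]e addrAC subrr add0r.
have P0 : rho_prod s x != 0 by rewrite gt_eqF// rho_prod_gt0.
rewrite -e; field.
by rewrite P0 gt_eqF.
Qed.

Lemma green_term_le_green_sum M n :
  \sum_(1 <= x < n.+1) green_term s x (scale (tail x) M) <= green_sum s (n + M).+1.
Proof.
rewrite /green_sum [in leRHS](big_cat_nat (n := n.+1))//=; last by rewrite ltnS leq_addr.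
rewrite ler_wpDr//.
  apply: sumr_ge0 => y _; rewrite mulr_ge0 ?sqr_ge0// ltW//.
  exact: reversible_weight_gt0.
apply: ler_sum_nat => x /andP[x1 xn].
have xN : (x <= (n + M).+1)%N by lia.
apply: (@le_trans _ _ ((rho_prod s x)^-1 * hit0 s (n + M).+1 x ^+ 2)).
  rewrite hit0_green_term// le_green_term//.
    by apply: scale_ge0 => i; exact: s_gt0.
  by apply: le_scale => [i|]; [exact: s_gt0|lia].
rewrite ler_wpM2r ?sqr_ge0// lerDr invr_ge0 ltW//.
exact: rho_prod_gt0.
Qed.

(** The half 1 / Pi_(y-1) of the weight at y is charged to the summand at y - 1,
because hit0 is nonincreasing; the additional summand at 0 is 1. *)
Lemma green_sum_le_green_term N :
  green_sum s N.+1 <=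
  2 * (1 + \sum_(1 <= x < N.+1) green_term s x (scale (tail x) N.+1)).
Proof.
pose h x := (rho_prod s x)^-1 * hit0 s N.+1 x ^+ 2.
have h_ge0 x : 0 <= h x.
  by rewrite mulr_ge0 ?sqr_ge0// invr_ge0 ltW// rho_prod_gt0.
have hS x : (x <= N)%N -> (rho_prod s x)^-1 * hit0 s N.+1 x.+1 ^+ 2 <= h x.
  move=> xN; rewrite ler_wpM2l//; first by rewrite invr_ge0 ltW// rho_prod_gt0.
  rewrite ler_sqr ?nnegrE ?hit0_ge0//; last exact: leqW.
  rewrite ler_wpM2r ?invr_ge0 ?scale_ge0// lerD2l lerN2.
  exact: le_scale.
have h0 : h 0%N = 1.
  rewrite /h rho_prod0 /hit0 scale0 subr0 divff ?expr1n ?invr1 ?mulr1//.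
  by rewrite gt_eqF// (lt_le_trans ltr01)// scale_ge1.
rewrite (@le_trans _ _ (\sum_(1 <= x < N.+1) h x.-1 + \sum_(1 <= x < N.+1) h x))//.
  rewrite -big_split/=; apply: ler_sum_nat => -[//|x] /andP[_ xN].
  rewrite /reversible_weight/= mulrDl lerD2r hS//; lia.
have hle : \sum_(1 <= x < N.+1) h x <=
    \sum_(1 <= x < N.+1) green_term s x (scale (tail x) N.+1).
  apply: ler_sum_nat => x /andP[x1 xN].
  rewrite /h hit0_green_term//; last lia.
  apply: le_green_term; first by apply: scale_ge0 => i; exact: s_gt0.
  by apply: le_scale => [i|]; [exact: s_gt0|lia].
rewrite mulr2n mulrDl !mul1r lerD//; last by rewrite (le_trans hle)// lerDr.
rewrite big_add1/= (@le_trans _ _ (\sum_(0 <= i < N.+1) h i))//.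
  by rewrite big_nat_recr//= lerDl.
rewrite [in leLHS]big_ltn//. by rewrite h0 lerD2l.
Qed.

End GreenTerms.

(** * Exponentially decaying ratio products *)

Section RenewalCount.
Context {R : realType}.
Variables (eta : R) (eta_gt0 : 0 < eta).

Definition decays (s : nat -> R) := forall n, rho_prod s n <= expR (- (eta * n%:R)).

(** Sum of the geometric series that dominates the scale function of a decaying
sequence. *)
Definition decay_scale : R := (1 - expR (- eta))^-1.

Lemma decay_scale_gt0 : 0 < decay_scale.
Proof. by rewrite invr_gt0 subr_gt0 -[ltRHS]expR0 ltr_expR oppr_lt0. Qed.

Variable s : nat -> R.
Hypothesis s_gt0 : forall x, 0 < s x.

Lemma scale_le_decay_scale n : decays s -> scale s n <= decay_scale.
Proof.
move=> ds; pose q := expR (- eta).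
have q1 : q < 1 by rewrite -[ltRHS]expR0 ltr_expR oppr_lt0.
apply: (@le_trans _ _ (\sum_(j < n) q ^+ j)).
  apply: ler_sum => j _; rewrite (le_trans (ds j))//.
  by rewrite /q -expRM_natl -mulNr mulrC.
rewrite /decay_scale -/q -[leRHS]mul1r ler_pdivlMr ?subr_gt0//.
rewrite mulrC -opprB mulNr -subrX1.
by rewrite opprB gerBl exprn_ge0// expR_ge0.
Qed.

(** After each counted index y the product never climbs back above
exp (- eta k) times its value at y, so that its logarithm drops by at least eta
from one counted index to the next, inside an interval of length ln c. The
induction records the level reached at the last counted index. *)
Lemma renewal_count v c n : 0 < v -> 1 <= c ->
  \sum_(y < n) (`[< 1 <= rho_prod s y * v < c /\
    decays (fun i => s (y + i)%N) >] : nat)%:R <= 1 + ln c / eta :> R.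
Proof.
move=> v0 c1; pose b (y : nat) := `[< 1 <= rho_prod s y * v < c /\
    decays (fun i => s (y + i)%N) >].
have lnc : 0 <= ln c / eta by rewrite divr_ge0 ?ln_ge0// ltW.
have P0 y : 0 < rho_prod s y * v by rewrite mulr_gt0// rho_prod_gt0.
pose level y := (ln c - ln (rho_prod s y * v)) / eta.
suff [->|[y [_ /asboolP[/andP[y1 _] _] h]]] : \sum_(y < n) (b y : nat)%:R = 0 :> R \/
    exists y, [/\ (y < n)%N, b y & \sum_(y < n) (b y : nat)%:R <= 1 + level y].
- by rewrite addr_ge0.
- rewrite (le_trans h)// lerD2l /level ler_wpM2r ?invr_ge0 ?(ltW eta_gt0)//.
  by rewrite gerBl ln_ge0.
elim: n => [|n IH]; first by left; rewrite big_ord0.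
rewrite big_ord_recr/=; have [bn|_] := boolP (b n); last first.
  rewrite addr0; case: IH => [->|[y [yn by_ h]]]; [by left|right].
  by exists y; split=> //; exact: ltnW.
right; exists n; split=> //.
have /asboolP[/andP[n1 nc] _] := bn.
case: IH => [->|[y [yn /asboolP[_ dy] h]]].
  by rewrite add0r lerDl divr_ge0 ?(ltW eta_gt0)// subr_ge0 ler_ln ?posrE// ?ltW// (lt_le_trans _ c1).
have lnS : ln (rho_prod s n * v) <= ln (rho_prod s y * v) - eta.
  rewrite -(subnKC (ltnW yn)) rho_prodD -mulrA mulrCA lnM ?posrE// ?rho_prod_gt0//.
  rewrite addrC lerD2l -[leRHS]expRK ler_ln ?posrE ?expR_gt0 ?rho_prod_gt0//.
  rewrite (le_trans (dy _))// ler_expR lerN2 -[leLHS]mulr1 ler_pM2l//.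
  by rewrite ler1n subn_gt0.
rewrite (le_trans (lerD h (lexx _)))//.
rewrite -addrA lerD2l /level -[X in _ + X](divff (lt0r_neq0 eta_gt0)) -mulrDl.
by rewrite ler_wpM2r ?invr_ge0 ?(ltW eta_gt0)//; lra.
Qed.

End RenewalCount.

(** * First return under the quenched law *)

Section Quenched.
Local Open Scope ereal_scope.

Lemma measurable_position (n : nat) (k : int) :
  measurable [set X : trajectory | X n = k].
Proof. by apply: sub_sigma_algebra; exists n => //; exists k. Qed.

Lemma measurable_positions_le (n : nat) (p : nat -> int) :
  measurable [set X : trajectory | forall k, (k <= n)%N -> X k = p k].
Proof.
rewrite [X in measurable X](_ : _ = \bigcap_(k in [set k | (k <= n)%N])
  [set X : trajectory | X k = p k])//.
by apply: bigcap_measurableType => k _; exact: measurable_position.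
Qed.

Lemma measurable_avoid (P : set nat) (f : nat -> nat) (z : int) :
  measurable [set X : trajectory | forall k, P k -> X (f k) != z].
Proof.
rewrite [X in measurable X](_ : _ = \bigcap_(k in P)
  ~` [set X : trajectory | X (f k) = z]); last first.
  apply/seteqP; split=> X /= h k Pk; first exact/eqP/h.
  by apply/eqP; exact: h.
by apply: bigcap_measurableType => k _; apply: measurableC; exact: measurable_position.
Qed.

Context {R : realType} (Q : R.-pker (environment R) ~> trajectory).
Hypothesis quenchedQ : quenched_law Q.
Variable w : environment R.

(* Paths are prescribed up to time n; beyond it, hits only asks for the first
   visit to 0 from time n on to occur at time n + m. *)
Let prefix n (p : nat -> int) :=
  [set X : trajectory | forall k, (k <= n)%N -> X k = p k].

Let ext n (p : nat -> int) y := fun i => if (i <= n)%N then p i else y : int.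

Let hits n (p : nat -> int) m := [set X : trajectory |
  [/\ prefix n p X, forall j, (j < m)%N -> X (n + j)%N != 0%R
    & X (n + m)%N = 0%R]].

Let measurable_hits n p m : measurable (hits n p m).
Proof.
rewrite [X in measurable X](_ : _ = prefix n p `&`
  [set X : trajectory | forall j, (j < m)%N -> X (n + j)%N != 0%R] `&`
  [set X : trajectory | X (n + m)%N = 0%R]).
  by apply: measurableI; [apply: measurableI|];
    [exact: measurable_positions_le|exact: measurable_avoid|exact: measurable_position].
by apply/seteqP; split => X /= [] => [h1 h2 h3|[h1 h2] h3]; split.
Qed.

Let prefix_ext n p y : prefix n.+1 (ext n p y) =
  [set X : trajectory | (forall k, (k <= n)%N -> X k = p k) /\ X n.+1 = y].
Proof.
apply/seteqP; split=> X /=.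
  move=> h; split=> [k kn|]; last by rewrite h// /ext ltnn.
  by rewrite h ?leqW// /ext kn.
move=> [h1 h2] k; rewrite leq_eqVlt => /predU1P[->|].
  by rewrite h2 /ext ltnn.
by rewrite ltnS => kn; rewrite h1// /ext kn.
Qed.

Let step n p y : Q w (prefix n.+1 (ext n p y)) =
  Q w (prefix n p) * (jump_prob w (p n) y)%:E.
Proof. by rewrite prefix_ext; have [_ ->] := quenchedQ w. Qed.

Let neighbours (x : int) : (x + 1 != x - 1)%R.
Proof. lia. Qed.

(** The two neighbours of the last position already carry the whole mass. *)
Let stray_null n p : Q w (prefix n p `\` (prefix n.+1 (ext n p (p n + 1)%R) `|`
  prefix n.+1 (ext n p (p n - 1)%R))) = 0.
Proof.
have mp m p' : measurable (prefix m p') by exact: measurable_positions_le.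
have fin A : measurable A -> Q w A \is a fin_num.
  have QT : Q w setT = 1 by exact: prob_kernel.
  move=> mA; rewrite ge0_fin_numE// (@le_lt_trans _ _ 1) ?ltry//.
  by rewrite -QT le_measure ?inE.
rewrite measureD//; last 2 first.
  exact: measurableU.
  by rewrite -ge0_fin_numE// fin.
rewrite setIidr; last first.
  move=> X; rewrite !prefix_ext => -[] /= [h _]; exact: h.
rewrite measureU//; last first.
  rewrite !prefix_ext; apply/seteqP; split=> X //= -[[_ ->] [_ /eqP]].
  by rewrite (negbTE (neighbours _)).
apply: (eq_trans (congr2 (fun a b => Q w (prefix n p) - (a + b))
  (step _ _ _) (step _ _ _))).
rewrite /jump_prob eqxx ifN ?eqxx//; last by rewrite eq_sym neighbours.
rewrite -ge0_muleDr ?lee_fin ?subr_ge0//; last 2 first.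
- by rewrite /env_at.
- by rewrite /env_at.
by rewrite -EFinD (addrC (env_at _ _)) subrK mule1 subee// fin.
Qed.

(** Markov property, by induction on m: the next position is one of the two
neighbours of x, up to a null event. *)
Lemma measure_hits n p m (x : nat) : p n = x%:Z ->
  Q w (hits n p m) =
  Q w (prefix n p) * (first_hit (fun x : nat => env_at x%:Z w) m x)%:E.
Proof.
elim: m n p x => [|m IH] n p [|x] pn.
- rewrite mule1; congr (Q w _); apply/seteqP; split=> X /=.
    by move=> [].
  by move=> h; split=> //; rewrite addn0 h.
- rewrite mule0 (_ : hits _ _ _ = set0) ?measure0//.
  apply/seteqP; split=> X //= -[h _]; rewrite addn0 h// pn; lia.
- rewrite mule0 (_ : hits _ _ _ = set0) ?measure0//.
  apply/seteqP; split=> X //= -[h /(_ 0%N isT)]; rewrite addn0 h// pn eqxx; lia.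
pose y := (p n + 1)%R; pose z := (p n - 1)%R.
pose stray := prefix n p `\` (prefix n.+1 (ext n p y) `|` prefix n.+1 (ext n p z)).
have hitsE : hits n p m.+1 =
    (hits n.+1 (ext n p y) m `|` hits n.+1 (ext n p z) m) `|`
    (hits n p m.+1 `&` stray).
  apply/seteqP; split=> X /=.
    move=> hX; have [h1 h2 h3] := hX.
    have [h4|h4] := pselect ((prefix n.+1 (ext n p y) `|`
        prefix n.+1 (ext n p z)) X); last by right; split.
    left; case: h4 => h4; [left|right]; split=> //.
    - by move=> j jm; rewrite addSnnS h2.
    - by rewrite addSnnS.
    - by move=> j jm; rewrite addSnnS h2.
    - by rewrite addSnnS.
  case=> [|[]//] [] [] h1 h2 h3; (split; last by rewrite -addSnnS).
  - by move: h1; rewrite prefix_ext => -[].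
  - move: h1; rewrite prefix_ext => -[h1 _] [_|j jm].
      by rewrite addn0 h1// pn.
    by rewrite -addSnnS h2.
  - by move: h1; rewrite prefix_ext => -[].
  - move: h1; rewrite prefix_ext => -[h1 _] [_|j jm].
      by rewrite addn0 h1// pn.
    by rewrite -addSnnS h2.
have mstray : measurable stray.
  by apply: measurableD; [|apply: measurableU]; exact: measurable_positions_le.
rewrite hitsE measureU0//; last 3 first.
- exact: measurableU.
- exact: measurableI.
- apply: (@subset_measure0 _ _ _ (Q w) _ stray) => //.
  + exact: measurableI.
  + exact: stray_null.
rewrite measureU//; last first.
  apply/seteqP; split=> X //= -[[h _ _] [h' _ _]]; move: h h'.
  rewrite !prefix_ext => -[_ hy] [_ hz].
  by have := neighbours (p n); rewrite -/y -/z -hy -hz eqxx.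
have hy : ext n p y n.+1 = x.+2%:Z by rewrite /ext ltnn /y pn; lia.
have hz : ext n p z n.+1 = x%:Z by rewrite /ext ltnn /z pn; lia.
apply: (eq_trans (congr2 (fun a b => a + b) (IH _ _ _ hy) (IH _ _ _ hz))).
rewrite !step /jump_prob eqxx ifN ?eqxx//; last first.
  by rewrite eq_sym neighbours.
have f0 k : (0 <= first_hit (fun x : nat => env_at x%:Z w) m k)%R.
  by apply: first_hit_ge0 => i; rewrite /env_at ge0 le1.
rewrite -!muleA -ge0_muleDr ?mule_ge0// ?lee_fin ?subr_ge0//; last 2 first.
- by rewrite /env_at ge0.
- by rewrite /env_at le1.
by rewrite pn -!EFinM -EFinD.
Qed.

Lemma quenched_first_return n :
  Q w [set X : trajectory | [/\ X 0%N = 0%R, X 1%N = 1%R,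
    forall j, (j < n)%N -> X j.+1 != 0%R & X n.+1 = 0%R]] =
  (env_at 0 w * first_hit (fun x : nat => env_at x%:Z w) n 1)%:E.
Proof.
rewrite EFinM; pose p k : int := (k == 1)%N.
transitivity (Q w (hits 1 p n)).
  congr (Q w _); apply/seteqP; split=> X /=.
    by move=> [X0 X1 h1 h2]; split=> // -[|[|k]].
  by move=> [h1 h2 h3]; split=> //; rewrite h1.
rewrite (measure_hits _ (x := 1%N))//; congr (_ * _).
have [Q0 Qn] := quenchedQ w.
have -> : prefix 1 p =
    [set X | (forall k, (k <= 0)%N -> X k = 0%R :> int) /\ X 1%N = 1%R].
  apply/seteqP; split=> X /=.
    by move=> h; split=> [[|//] _|]; rewrite h.
  by move=> [h1 h2] [|[|k]]//; rewrite h1.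
rewrite (Qn 0%N (fun=> 0%R)) /jump_prob add0r eqxx.
rewrite (_ : [set X | _] = [set X : trajectory | X 0%N = 0%R]) ?Q0 ?mul1e//.
by apply/seteqP; split=> X /= => [->//|h [|]].
Qed.

End Quenched.

(** * Stationarity and independence of the environment *)

Section IidEnvironment.
Local Open Scope ereal_scope.
Context {R : realType}.
Implicit Types (P : probability (environment R) R) (w : environment R).

(** An environment that copies two environments on complementary sets of sites, up
to translations. When the two are independent with law P the result has law P
(splice_law); this single fact carries both the stationarity of the environment
and the independence of its past and its future. *)
Definition splice (c : pred int) (a b : int)
    (w2 : environment R * environment R) : environment R :=
  fun x => if c x then w2.1 (x + a)%R else w2.2 (x + b)%R.

Definition shift (k : int) w : environment R := fun x => w (x + k)%R.

Lemma measurable_env_at x : measurable_fun setT (@env_at R x).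
Proof.
move=> _ B mB; rewrite setTI; apply: sub_sigma_algebra.
by exists x => //; exists B.
Qed.

Lemma measurable_to_environment d (T : measurableType d) (f : T -> environment R) :
  (forall x, measurable_fun setT (fun t => env_at x (f t))) ->
  measurable_fun setT f.
Proof.
move=> mf; apply: (@measurability _ _ T (environment R) setT f (@env_cylinders R)) => //.
move=> _ [_ [x _ [B mB <-]] <-]; exact: mf.
Qed.

Lemma measurable_splice c a b : measurable_fun setT (splice c a b).
Proof.
apply: measurable_to_environment => x; rewrite /splice /env_at.
case: (c x).
- exact: (measurableT_comp (measurable_env_at _) measurable_fst).
- exact: (measurableT_comp (measurable_env_at _) measurable_snd).
Qed.

Lemma measurable_shift k : measurable_fun setT (shift k).
Proof. by apply: measurable_to_environment => x; exact: measurable_env_at. Qed.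

Lemma measurable_shift_preimage k (A : set (environment R)) :
  measurable A -> measurable (shift k @^-1` A).
Proof.
move=> mA; rewrite -[X in measurable X]setTI.
by apply: (measurable_shift k).
Qed.

Definition box (s : {fset int}) (B : int -> set R) : set (environment R) :=
  \bigcap_(x in [set` s]) (env_at x @^-1` B x).

Lemma measurable_box s B : (forall x, measurable (B x)) -> measurable (box s B).
Proof.
move=> mB; apply: fin_bigcap_measurable => // x _.
by rewrite -[X in measurable X]setTI; exact: measurable_env_at.
Qed.

(** Boxes are stable under intersection and generate the product sigma-algebra. *)
Lemma boxes_determine (m1 m2 : {measure set (environment R) -> \bar R}) :
  (forall s B, (forall x, measurable (B x)) -> m1 (box s B) = m2 (box s B)) ->
  m1 setT < +oo -> forall A, measurable A -> m1 A = m2 A.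
Proof.
move=> m12 m1T A mA.
pose G := [set A | exists s B, (forall x, measurable (B x)) /\ A = box s B].
have boxT : box fset0 (fun=> setT) = setT.
  by apply/seteqP; split=> // w _ x; rewrite /= inE.
apply: (measure_unique G (fun=> setT)) => //.
- apply/seteqP; split=> X.
    apply: smallest_sub; first exact: smallest_sigma_algebra.
    move=> _ [x _ [B mB <-]]; apply: sub_sigma_algebra.
    exists [fset x]%fset, (fun=> B); split=> //; apply/seteqP; split=> w /=.
      by move=> Bw y /=; rewrite inE => /eqP ->.
    by apply; rewrite /= inE.
  apply: smallest_sub; first exact: sigma_algebra_measurable.
  by move=> _ [s [B [mB ->]]]; exact: measurable_box.
- move=> _ _ [s [B [mB ->]]] [s' [B' [mB' ->]]].
  exists (s `|` s')%fset, (fun x => (if x \in s then B x else setT) `&`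
    (if x \in s' then B' x else setT)); split.
    by move=> x; apply: measurableI; case: ifP.
  apply/seteqP; split=> w.
    move=> [h h'] x /= xs; split; case: ifP => //.
      by move=> ?; exact: h.
    by move=> ?; exact: h'.
  move=> h; split=> x /= xs; have := h x; rewrite /= in_fsetU xs ?orbT/=.
    by move=> /(_ isT) [].
  by move=> /(_ isT) [].
- by move=> _; exists fset0, (fun=> setT).
- by apply/seteqP; split=> // w _; exists 0%N.
- by move=> _ [s [B [mB ->]]]; exact: m12.
Qed.

Variable P : probability (environment R) R.
Hypothesis iidP : iid_environment P.

Lemma probability_box s B : (forall x, measurable (B x)) ->
  P (box s B) = \prod_(x <- s) P (env_at 0%R @^-1` B x).
Proof.
move=> mB; rewrite /box (iidP.2 s B mB); apply: eq_bigr => x _.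
exact: iidP.1.
Qed.

Let probability_translated_box (c : pred int) (a : int) (s : {fset int}) B :
  (forall x, measurable (B x)) ->
  P [set w | forall x, x \in s -> c x -> B x (env_at (x + a)%R w)] =
  \prod_(x <- s) (if c x then P (env_at 0%R @^-1` B x) else 1).
Proof.
move=> mB; pose s' := [fset (x + a)%R | x in s]%fset.
pose B' y := if c (y - a)%R then B (y - a)%R else setT.
transitivity (P (box s' B')).
  congr (P _); apply/seteqP; split=> w /=.
    move=> h y /= /imfsetP[x /= xs ->]; rewrite /B' addrK.
    by case: ifPn => // cx; exact: h.
  move=> h x xs cx; have := h (x + a)%R.
  rewrite /B' addrK cx; apply; apply/imfsetP; by exists x.
rewrite probability_box; last by move=> x; rewrite /B'; case: ifP.
rewrite big_imfset/=; last by move=> x y _ _ /addIr.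
apply: eq_bigr => x _; rewrite /B' addrK; case: ifP => // _.
by rewrite preimage_setT probability_setT.
Qed.

Lemma splice_law c a b A : measurable A ->
  (P \x P) (splice c a b @^-1` A) = P A.
Proof.
move=> mA.
pose mu : {measure set _ -> \bar R} := P.
pose nu : {measure set _ -> \bar R} := pushforward (P \x P) (splice c a b).
pose nuS := nu (measurable_splice c a b).
suff : nuS A = mu A by [].
apply: boxes_determine => //; last first.
  rewrite /nuS /nu/= /pushforward preimage_setT -setXTT product_measure1E//.
  have -> : P setT * P setT = 1 by rewrite probability_setT mule1.
  exact: ltry.
move=> s B mB; rewrite /nuS /nu/= /pushforward.
rewrite [X in (P \x P) X](_ : _ =
  [set w | forall x, x \in s -> c x -> B x (env_at (x + a)%R w)] `*`
  [set w | forall x, x \in s -> ~~ c x -> B x (env_at (x + b)%R w)]); last first.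
  apply/seteqP; split=> -[w w'] /=.
    move=> h; split=> x xs cx; have := h x xs;
      by rewrite /= /splice /env_at ?cx ?(negbTE cx).
  move=> [h h'] x xs; rewrite /= /splice /env_at.
  by case: ifPn => cx; [exact: h|exact: h'].
have mbox (d : pred int) k :
    measurable [set w | forall x, x \in s -> d x -> B x (env_at (x + k)%R w)].
  rewrite [X in measurable X](_ : _ = \bigcap_(x in [set x | x \in s /\ d x])
      (env_at (x + k)%R @^-1` B x)); last first.
    apply/seteqP; split=> w /= h; first by move=> x [xs dx]; exact: h.
    by move=> x xs dx; exact: h.
  apply: fin_bigcap_measurable => [|x _].
    by apply: (@sub_finite_set _ _ [set` s]) => // x [].
  by rewrite -[X in measurable X]setTI; exact: measurable_env_at.
rewrite product_measure1E//.
rewrite [X in X * _]probability_translated_box//.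
rewrite [X in _ * X](probability_translated_box (fun x => ~~ c x))//.
rewrite [RHS]probability_box// -big_split/=; apply: eq_bigr => x _.
by case: (c x); rewrite ?mule1 ?mul1e.
Qed.

Lemma expectation_splice c a b (F : environment R -> \bar R)
    (mF : measurable_fun setT F) (F0 : forall w, 0 <= F w) :
  \int[P]_w F w = \int[P]_w \int[P]_w' F (splice c a b (w, w')).
Proof.
rewrite -(fubini_tonelli1 (fun z => F (splice c a b z)))//; last first.
  by apply: measurableT_comp => //; exact: measurable_splice.
rewrite -(ge0_integral_pushforward (measurable_splice c a b) _ (D := setT) (f := F))//.
pose nu : {measure set _ -> \bar R} := pushforward (P \x P) (splice c a b).
apply: (@eq_measure_integral _ _ _ setT (nu (measurable_splice c a b)) P).
by move=> A mA _; exact/esym/splice_law.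
Qed.

Lemma shift_law k A : measurable A -> P (shift k @^-1` A) = P A.
Proof.
move=> mA; rewrite -(splice_law xpredT k 0 mA).
rewrite (_ : _ @^-1` A = (shift k @^-1` A) `*` setT); last first.
  by apply/seteqP; split=> [[w w']|[w w']] //= [].
rewrite product_measure1E//; last first.
  exact: measurable_shift_preimage.
by rewrite [X in _ * X]probability_setT mule1.
Qed.

Lemma expectation_shift k (F : environment R -> \bar R)
    (mF : measurable_fun setT F) (F0 : forall w, 0 <= F w) :
  \int[P]_w F (shift k w) = \int[P]_w F w.
Proof.
rewrite -(ge0_integral_pushforward (measurable_shift k) _ (D := setT) (f := F))//.
pose nu : {measure set _ -> \bar R} := pushforward P (shift k).
apply: (@eq_measure_integral _ _ _ setT P (nu (measurable_shift k))).
by move=> A mA _; exact: shift_law.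
Qed.

End IidEnvironment.

(** * Ratios of the environment *)

Section Ratios.
Local Open Scope ereal_scope.
Context {R : realType}.
Implicit Types (P : probability (environment R) R) (w : environment R).

Lemma measurable_funV_gt0 d (T : measurableType d) (f : T -> R) :
  (forall t, 0 < f t)%R -> measurable_fun setT f ->
  measurable_fun setT (fun t => (f t)^-1%R).
Proof.
move=> f0 mf; rewrite (_ : (fun t => _) = (fun t => expR (- ln (f t)))); last first.
  by apply/funext => t; rewrite expRN lnK// posrE.
apply: measurableT_comp; first exact: measurable_expR.
apply: measurableT_comp; first exact: oppr_measurable.
by apply: measurableT_comp => //; exact: measurable_ln.
Qed.

(** The value 1 outside the open unit interval makes all ratios positive, so that
inverses and logarithms make sense for every environment; almost every
environment never uses it (ae_elliptic). *)
Definition site_ratio (t : R) : R := (if 0 < t < 1 then (1 - t) / t else 1)%R.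

Definition ratios w (i : nat) : R := site_ratio (env_at i%:Z w).

Lemma site_ratio_gt0 t : (0 < site_ratio t)%R.
Proof.
rewrite /site_ratio; case: ifPn => // /andP[t0 t1].
by rewrite divr_gt0// subr_gt0.
Qed.

Lemma ratios_gt0 w i : (0 < ratios w i)%R.
Proof. exact: site_ratio_gt0. Qed.

Lemma measurable_site_ratio : measurable_fun setT site_ratio.
Proof.
pose g (t : R) : R := (if 0 < t then t else 1)%R.
(* The auxiliary g is positive everywhere, as the measurability of the inverse
   requires, and agrees with the identity where it matters. *)
rewrite (_ : site_ratio = fun t => if (0 < t)%R && (t < 1)%R then
  ((1 - t) * (g t)^-1)%R else 1%R); last first.
  apply/funext => t; rewrite /site_ratio /g; case: ifPn => // /andP[-> _] //.
apply: measurable_fun_ifT => //.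
- by apply: measurable_and; exact: measurable_fun_ltr.
- apply: measurable_funM; first exact: measurable_funB.
  apply: measurable_funV_gt0; first by move=> t; rewrite /g; case: ifP.
  by apply: measurable_fun_ifT => //; exact: measurable_fun_ltr.
Qed.

Lemma measurable_ratios i : measurable_fun setT (fun w => ratios w i).
Proof.
by apply: (measurableT_comp measurable_site_ratio); exact: measurable_env_at.
Qed.

Lemma ratios_shift (n : nat) w : ratios (shift n%:Z w) = fun i => ratios w (n + i)%N.
Proof. by apply/funext => i; rewrite /ratios /env_at /shift -PoszD addnC. Qed.

Lemma ratios_shiftS (k : int) w :
  ratios (shift k w) \o succn = ratios (shift (k + 1)%R w).
Proof.
apply/funext => i; rewrite /ratios /env_at /shift/=; congr (site_ratio (w _)%:num).
lia.
Qed.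

Lemma measurable_rho_prod n : measurable_fun setT (fun w => rho_prod (ratios w) n).
Proof. by apply: measurable_prod => i _; exact: measurable_ratios. Qed.

Lemma measurable_scale n : measurable_fun setT (fun w => scale (ratios w) n).
Proof. by apply: measurable_sum => i; exact: measurable_rho_prod. Qed.

Lemma eq_rho_prod (s s' : nat -> R) n :
  (forall i, (0 < i <= n)%N -> s i = s' i) -> rho_prod s n = rho_prod s' n.
Proof. by move=> h; apply: eq_bigr => i _; apply: h => /=; exact: ltn_ord. Qed.

Lemma eq_scale (s s' : nat -> R) n :
  (forall i, (0 < i < n)%N -> s i = s' i) -> scale s n = scale s' n.
Proof.
move=> h; apply: eq_bigr => i _; apply: eq_rho_prod => j /andP[j0 ji].
by apply: h; rewrite j0/= (leq_ltn_trans ji).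
Qed.

Variable P : probability (environment R) R.
Hypothesis iidP : iid_environment P.

(** The environment up to n and the environment seen from n are independent, and
the latter has law P. *)
Lemma expectation_past_future (n : nat) (H : environment R -> environment R -> \bar R) :
  measurable_fun setT (fun z => H z.1 z.2) -> (forall w w', 0 <= H w w') ->
  (forall w1 w2 w', (forall x : int, (x <= n%:Z)%R -> w1 x = w2 x) ->
     H w1 w' = H w2 w') ->
  (forall w w1 w2, (forall x : int, (0 < x)%R -> w1 x = w2 x) ->
     H w w1 = H w w2) ->
  \int[P]_w H w (shift n%:Z w) = \int[P]_w \int[P]_w' H w w'.
Proof.
move=> mH H0 past future.
rewrite (expectation_splice iidP (fun x => x <= n%:Z)%R 0%R (- n%:Z)%R); last 2 first.
- exact: (measurableT_comp mH (measurable_fun_pair (@measurable_id _ _ setT)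
    (measurable_shift n%:Z))).
- by [].
apply: eq_integral => w _; apply: eq_integral => w' _.
rewrite (past _ w); last by move=> x xn; rewrite /splice xn addr0.
apply: future => x x0; rewrite /shift /splice ifF ?addrK//; lia.
Qed.

Lemma expectation_ratios i :
  \int[P]_w (ratios w i)%:E = \int[P]_w (ratios w 0)%:E.
Proof.
rewrite -(expectation_shift iidP i%:Z (F := fun w => (ratios w 0)%:E)).
- by apply: eq_integral => w _; rewrite ratios_shift addn0.
- by apply/measurable_EFinP; exact: measurable_ratios.
- by move=> w; rewrite lee_fin ltW// ratios_gt0.
Qed.

Lemma expectation_rho_prod n :
  \int[P]_w (rho_prod (ratios w) n)%:E = (\int[P]_w (ratios w 0)%:E) ^+ n.
Proof.
elim: n => [|n IH].
  under eq_integral do rewrite rho_prod0.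
  by rewrite integral_cst// mul1e expe0; exact: probability_setT.
transitivity (\int[P]_w \int[P]_w' ((rho_prod (ratios w) n)%:E * (ratios w' 1)%:E)).
  rewrite -(expectation_past_future (n := n) (H := fun w w' =>
    (rho_prod (ratios w) n)%:E * (ratios w' 1)%:E)).
  - apply: eq_integral => w _.
    by rewrite rho_prodSr ratios_shift addn1 EFinM.
  - apply: emeasurable_funM; apply/measurable_EFinP.
      exact: (measurableT_comp (measurable_rho_prod _)).
    exact: (measurableT_comp (measurable_ratios _)).
  - move=> w w'; rewrite mule_ge0// lee_fin ltW// ?ratios_gt0//.
    by rewrite rho_prod_gt0// => i; exact: ratios_gt0.
  - move=> w1 w2 w' h; congr (_%:E * _); apply: eq_rho_prod => i /andP[_ iN].
    by rewrite /ratios /env_at h.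
  - by move=> w w1 w2 h; rewrite /ratios /env_at h.
under eq_integral => w _.
  rewrite ge0_integralZl//; last 3 first.
  - by apply/measurable_EFinP; exact: measurable_ratios.
  - by move=> w' _; rewrite lee_fin ltW// ratios_gt0.
  - by rewrite lee_fin ltW// rho_prod_gt0// => i; exact: ratios_gt0.
  rewrite expectation_ratios; over.
rewrite ge0_integralZr//; last 3 first.
- by apply/measurable_EFinP; exact: measurable_rho_prod.
- by move=> w _; rewrite lee_fin ltW// rho_prod_gt0// => i; exact: ratios_gt0.
- by apply: integral_ge0 => w _; rewrite lee_fin ltW// ratios_gt0.
by rewrite IH muleC -expeS.
Qed.

Lemma expectation_scale n :
  \int[P]_w (scale (ratios w) n)%:E =
  \sum_(j < n) (\int[P]_w (ratios w 0)%:E) ^+ j.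
Proof.
under eq_integral => w _ do rewrite /scale -sumEFin.
rewrite ge0_integral_sum//.
- by apply: eq_bigr => j _; exact: expectation_rho_prod.
- by move=> j; apply/measurable_EFinP; exact: measurable_rho_prod.
- by move=> j w _; rewrite lee_fin ltW// rho_prod_gt0// => i; exact: ratios_gt0.
Qed.

End Ratios.

(** * A maximal ergodic lemma *)

Section MaximalErgodic.
Local Open Scope ereal_scope.
Context d (T : measurableType d) {R : realType} (P : probability T R).
Variable theta : T -> T.
Hypothesis mtheta : measurable_fun setT theta.
Hypothesis theta_law : forall A, measurable A -> P (theta @^-1` A) = P A.
Variable f : T -> R.
Hypothesis intf : P.-integrable setT (EFin \o f).

Let mf : measurable_fun setT f.
Proof. by apply/measurable_EFinP; exact: measurable_int intf. Qed.

(** Maximum of the partial sums of f along the orbit, including the empty sum. *)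
Fixpoint running_max n (t : T) : R :=
  (if n is n'.+1 then Num.max 0 (f t + running_max n' (theta t)) else 0)%R.

Let measurable_running_max n : measurable_fun setT (running_max n).
Proof.
elim: n => [|n IH]; first exact: measurable_cst.
apply: measurable_maxr => //; apply: measurable_funD => //.
exact: measurableT_comp.
Qed.

Let running_max_ge0 n t : (0 <= running_max n t)%R.
Proof. by case: n => [|n] //=; rewrite le_max lexx. Qed.

Let running_max_le n t : (running_max n t <= running_max n.+1 t)%R.
Proof.
elim: n t => [|n IH] t; first exact: running_max_ge0.
by rewrite [leLHS]/= [leRHS]/= ge_max le_max lexx/= le_max lerD2l IH orbT.
Qed.

Let theta_integral (g : T -> \bar R) : measurable_fun setT g ->
  (forall t, 0 <= g t) -> \int[P]_t g (theta t) = \int[P]_t g t.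
Proof.
move=> mg g0.
rewrite -(ge0_integral_pushforward mtheta _ (D := setT) (f := g))//.
pose nu : {measure set _ -> \bar R} := pushforward P theta.
apply: (@eq_measure_integral _ _ _ setT P (nu mtheta)).
by move=> A mA _; exact: theta_law.
Qed.

Let integrable_comp_theta (g : T -> R) : P.-integrable setT (EFin \o g) ->
  P.-integrable setT (EFin \o (g \o theta)).
Proof.
move=> /integrableP[mg ig]; apply/integrableP; split.
  apply/measurable_EFinP; apply: measurableT_comp => //.
  exact/measurable_EFinP.
rewrite (theta_integral (g := fun t => `|(g t)%:E|))//.
by apply: measurableT_comp.
Qed.

Let integrable_running_max n : P.-integrable setT (EFin \o running_max n).
Proof.
elim: n => [|n IH]; first exact: integrable0.
have iT := integrable_comp_theta IH.
apply: (le_integrable measurableT _ _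
  (integrableD measurableT (integrable_abse intf) iT)).
  by apply/measurable_EFinP; exact: measurable_running_max.
move=> t _ /=; rewrite lee_fin [leRHS]ger0_norm; last by rewrite addr_ge0.
rewrite ger0_norm ?le_max ?lexx// ge_max addr_ge0//= lerD2r ler_norm.
by [].
Qed.

Let drift n t : R := (if 0 < running_max n t then f t else 0)%R.

Let measurable_drift n : measurable_fun setT (drift n).
Proof. by apply: measurable_fun_ifT => //; exact: measurable_fun_ltr. Qed.

Let drift_le n t : (`|drift n t| <= `|f t|)%R.
Proof. by rewrite /drift; case: ifP => // _; rewrite normr0. Qed.

Let integrable_drift n : P.-integrable setT (EFin \o drift n).
Proof.
apply: (le_integrable measurableT _ _ intf); first exact/measurable_EFinP.
by move=> t _; rewrite /= lee_fin drift_le.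
Qed.

(** Where running_max n is positive it equals f plus the earlier maximum along the
shifted orbit, which is at most running_max n after the shift. Hence f
restricted to that set dominates running_max n - running_max n \o theta, whose
mean is 0 by invariance. *)
Lemma maximal_ergodic n : 0 <= \int[P]_t (drift n t)%:E.
Proof.
case: n => [|n].
  by apply: integral_ge0 => t _; rewrite lee_fin /drift/= ltxx.
have iM := integrable_running_max n.+1.
have iMT : P.-integrable setT (EFin \o (running_max n.+1 \o theta)).
  exact: integrable_comp_theta.
have M_fin : \int[P]_t (running_max n.+1 t)%:E \is a fin_num.
  exact: integrable_fin_num.
rewrite (_ : 0 = \int[P]_t ((running_max n.+1 t)%:E -
    (running_max n.+1 (theta t))%:E)); last first.
  rewrite integralB_EFin//.
  rewrite (theta_integral (g := fun t => (running_max n.+1 t)%:E)) ?subee//.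
    exact/measurable_EFinP.
  by move=> t; rewrite lee_fin.
apply: (le_integral measurableT (integrableB measurableT iM iMT)
  (integrable_drift _)).
move=> t _; rewrite -EFinB lee_fin /drift; case: ifPn => [M0|].
  have := M0; rewrite [running_max n.+1 t]/= lt_max ltxx/= => /ltW/max_idPr ->.
  by rewrite lerBlDr lerD2l running_max_le.
by rewrite -leNgt => M0; rewrite subr_le0 (le_trans M0)// running_max_ge0.
Qed.

(** If almost surely some partial sum were positive, the integrals of the maximal
ergodic lemma would converge to the negative mean of f. *)
Lemma positive_probability_nonpositive_sums : \int[P]_t (f t)%:E < 0 ->
  0 < P [set t | forall n, (\sum_(i < n) f (iter i theta t) <= 0)%R].
Proof.
move=> f_neg; rewrite lt0e measure_ge0 andbT; apply/eqP => PE0.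
have sum_le n t : (\sum_(i < n) f (iter i theta t) <= running_max n t)%R.
  elim: n t => [|n IH] t; first by rewrite big_ord0.
  rewrite big_ord_recl/= le_max lerD2l; apply/orP; right.
  apply: le_trans (IH _); rewrite le_eqVlt; apply/orP; left; apply/eqP.
  by apply: eq_bigr => i _; rewrite -iterSr.
have mE : measurable [set t | forall n, (\sum_(i < n) f (iter i theta t) <= 0)%R].
  rewrite (_ : [set t | _] = \bigcap_n [set t | (\sum_(i < n) f (iter i theta t) <= 0)%R]).
    apply: bigcap_measurableType => n _; rewrite -[X in measurable X]setTI.
    apply: measurable_fun_le => //; apply: measurable_sum => i.
    apply: measurableT_comp => //.
    by elim: (i : nat) => [|k IH]; [exact: measurable_id|exact: measurableT_comp].
  by apply/seteqP; split=> t /= h n => [_|]; exact: h.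
have [] := @dominated_convergence _ _ _ P setT measurableT
  (fun n => EFin \o drift n) (EFin \o f) (abse \o (EFin \o f)).
- by move=> n; exact/measurable_EFinP.
- exact/measurable_EFinP.
- exists [set t | forall n, (\sum_(i < n) f (iter i theta t) <= 0)%R]; split => //.
  move=> t /= h n; rewrite leNgt; apply/negP => Sn. apply: h => _.
  have Mn m : (n <= m)%N -> (0 < running_max m t)%R.
    move=> nm; apply: (lt_le_trans (lt_le_trans Sn (sum_le _ _))).
    rewrite -(subnKC nm); elim: (m - n)%N => [|k IH]; first by rewrite addn0.
    by rewrite addnS (le_trans IH).
  apply: cvg_near_cst; near=> m; rewrite /= /drift Mn//; near: m.
  exact: nbhs_infty_ge.
- exact: integrable_abse.
- by apply: aeW => t n _; rewrite /= lee_fin drift_le.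
move=> _ _ h; move: f_neg; rewrite ltNge => /negP; apply.
rewrite -(cvg_lim _ h)//; apply: lime_ge; first exact: cvgP h.
by apply: nearW => n; exact: maximal_ergodic.
Unshelve. all: by end_near. Qed.

End MaximalErgodic.

(** * Upper bound by a telescoping sum *)

Section UpperBound.
Local Open Scope ereal_scope.
Context {R : realType}.
Implicit Types (w : environment R).

Lemma ratios_shift_cancel (x : nat) w :
  (fun i => ratios (shift (- x%:Z)%R w) (x + i)%N) = ratios w.
Proof.
rewrite -ratios_shift; apply/funext => i; rewrite /ratios /env_at /shift.
by rewrite addrK.
Qed.

(** In the environment translated by - x, the quotient b x of the scale function by
the ratio product at x increases by the inverse of the ratio product, and the
x-th summand is at most the increment of - a^2 / (b + a). The telescoping sum
is at most a^2 / (b 0 + a) = a. *)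
Lemma sum_green_term_backward w (a : R) N : (0 < a)%R ->
  (\sum_(1 <= x < N.+1) green_term (ratios (shift (- x%:Z) w)) x a <= a)%R.
Proof.
move=> a0.
pose u (x : nat) := ratios (shift (- x%:Z)%R w).
have u0 x i : (0 < u x i)%R by exact: ratios_gt0.
pose b x := (scale (u x) x / rho_prod (u x) x)%R.
have P0 x : (0 < rho_prod (u x) x)%R by exact: rho_prod_gt0.
have uS x : u x.+1 \o succn = u x.
  by rewrite /u ratios_shiftS; congr (ratios (shift _ w)); lia.
have b_ge0 x : (0 <= b x)%R by rewrite divr_ge0 ?(ltW (P0 _))// scale_ge0.
have bS x : (b x.+1 = b x + (rho_prod (u x.+1) x.+1)^-1)%R.
  have := P0 x; have := u0 x.+1 1%N => u1 Px.
  rewrite /b scaleSl rho_prodSl uS; field.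
  by rewrite !gt_eqF.
have step x : (green_term (u x.+1) x.+1 a <=
    a ^+ 2 * ((b x + a)^-1 - (b x.+1 + a)^-1))%R.
  have E : (scale (u x.+1) x.+1 = b x.+1 * rho_prod (u x.+1) x.+1)%R.
    by rewrite /b divfK// gt_eqF.
  rewrite /green_term E bS; have := P0 x.+1; set p := rho_prod _ _ => p0.
  have bx := b_ge0 x.
  have d0 : (0 < b x + a)%R by rewrite ltr_wpDl.
  have d1 : (0 < b x + p^-1 + a)%R.
    by rewrite addrAC addr_gt0// invr_gt0.
  have d2 : (0 < b x * p + 1 + a * p)%R.
    by rewrite addr_gt0 ?mulr_gt0// ltr_wpDl// mulr_ge0// ltW.
  have -> : (p * a ^+ 2 / ((b x + p^-1) * p + p * a) ^+ 2 =
     a ^+ 2 * (p^-1 / (b x + p^-1 + a) / (b x + p^-1 + a)))%R.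
    field; by rewrite !gt_eqF.
  rewrite ler_wpM2l ?sqr_ge0//.
  have -> : ((b x + a)^-1 - (b x + p^-1 + a)^-1 =
    p^-1 / (b x + p^-1 + a) / (b x + a))%R.
    field; by rewrite !gt_eqF.
  rewrite ler_wpM2l ?divr_ge0 ?invr_ge0 ?(ltW p0) ?(ltW d1)//.
  by rewrite lef_pV2 ?posrE// lerD2r lerDl invr_ge0 ltW.
rewrite big_add1/= (@le_trans _ _ (\sum_(0 <= x < N)
  a ^+ 2 * ((b x + a)^-1 - (b x.+1 + a)^-1)))%R//.
  by apply: ler_sum_nat => x _; exact: step.
rewrite -mulr_sumr.
have -> : (\sum_(0 <= x < N) ((b x + a)^-1 - (b x.+1 + a)^-1) =
    (b 0%N + a)^-1 - (b N + a)^-1)%R.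
  elim: N => [|N IH]; first by rewrite big_geq// subrr.
  by rewrite big_nat_recr//= IH addrA subrK.
rewrite /b scale0 mul0r add0r mulrBr expr2 mulfK ?gt_eqF//.
rewrite gerBl mulr_ge0 ?mulr_ge0 ?(ltW a0)// invr_ge0 addr_ge0 ?(ltW a0)//.
exact: b_ge0.
Qed.

Variable P : probability (environment R) R.
Hypothesis iidP : iid_environment P.

Lemma measurable_green_term d (T : measurableType d) (s : T -> nat -> R)
    (a : T -> R) x :
  (forall t i, 0 < s t i)%R -> (forall t, 0 < a t)%R ->
  measurable_fun setT (fun t => rho_prod (s t) x) ->
  measurable_fun setT (fun t => scale (s t) x) -> measurable_fun setT a ->
  measurable_fun setT (fun t => green_term (s t) x (a t)).
Proof.
move=> s0 a0 mP mA ma.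
apply: measurable_funM.
  by apply: measurable_funM => //; exact: measurable_funX.
apply: measurable_funV_gt0.
  move=> t; rewrite exprn_gt0// ltr_wpDl ?scale_ge0//.
  by rewrite mulr_gt0// rho_prod_gt0.
by apply: measurable_funX; apply: measurable_funD => //; exact: measurable_funM.
Qed.

Lemma measurable_green_sum N :
  measurable_fun setT (fun w => green_sum (ratios w) N).
Proof.
apply: measurable_sum => y; apply: measurable_funM.
  apply: measurable_funD; apply: measurable_funV_gt0.
  - by move=> w; apply: rho_prod_gt0; exact: ratios_gt0.
  - exact: measurable_rho_prod.
  - by move=> w; apply: rho_prod_gt0; exact: ratios_gt0.
  - exact: measurable_rho_prod.
apply: measurable_funX; case: N => [|N].
  rewrite (_ : (fun _ => _) = cst 0%R)//.
  by apply/funext => w; rewrite /hit0 scale0 invr0 mulr0.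
apply: measurable_funM; first by apply: measurable_funB; exact: measurable_scale.
apply: measurable_funV_gt0; last exact: measurable_scale.
by move=> w; rewrite (lt_le_trans ltr01)// scale_ge1//; exact: ratios_gt0.
Qed.

Lemma expectation_green_sum_le N :
  \int[P]_w (green_sum (ratios w) N.+1)%:E <=
  2%:E * (1 + \int[P]_w (scale (ratios w) N.+1)%:E).
Proof.
have scale_gt0 n w : (0 < scale (ratios w) n.+1)%R.
  by rewrite (lt_le_trans ltr01)// scale_ge1//; exact: ratios_gt0.
pose tm x w := green_term (ratios w) x (scale (fun i => ratios w (x + i)%N) N.+1).
have tm_ge0 x w : (0 <= tm x w)%R.
  by apply: green_term_ge0; exact: ratios_gt0.
have mtm x : measurable_fun setT (tm x).
  apply: measurable_green_term.
  - by move=> w i; exact: ratios_gt0.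
  - by move=> w; rewrite -ratios_shift.
  - exact: measurable_rho_prod.
  - exact: measurable_scale.
  - rewrite (_ : (fun w => _) = (fun w => scale (ratios (shift x%:Z w)) N.+1)).
      exact: (measurableT_comp (measurable_scale _) (measurable_shift _)).
    by apply/funext => w; rewrite ratios_shift.
have mtmb x : measurable_fun setT (fun w => tm x (shift (- x%:Z)%R w)).
  exact: (measurableT_comp (mtm x) (measurable_shift _)).
have le1 : \int[P]_w (\sum_(1 <= x < N.+1) tm x w)%:E <=
    \int[P]_w (scale (ratios w) N.+1)%:E.
  under eq_integral => w _ do rewrite -sumEFin.
  rewrite ge0_integral_sum//; last 2 first.
  - by move=> x; exact/measurable_EFinP.
  - by move=> x w _; rewrite lee_fin.
  rewrite (eq_bigr (fun x => \int[P]_w (tm x (shift (- x%:Z)%R w))%:E)); last first.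
    move=> x _; rewrite (expectation_shift iidP _ (F := fun w => (tm x w)%:E))//.
    - exact/measurable_EFinP.
    - by move=> w; rewrite lee_fin.
  rewrite -ge0_integral_sum//; last 2 first.
  - by move=> x; exact/measurable_EFinP.
  - by move=> x w _; rewrite lee_fin.
  apply: ge0_le_integral => //.
  - by move=> w _; apply: sume_ge0 => x _; rewrite lee_fin.
  - by apply: emeasurable_sum => x; exact/measurable_EFinP.
  - by apply/measurable_EFinP; exact: measurable_scale.
  move=> w _; rewrite sumEFin lee_fin /tm.
  under eq_bigr do rewrite ratios_shift_cancel.
  exact: sum_green_term_backward.
apply: (@le_trans _ _
  (\int[P]_w (2%:E * (1 + (\sum_(1 <= x < N.+1) tm x w)%:E)))).
  apply: ge0_le_integral => //.
  - move=> w _; rewrite lee_fin; apply: sumr_ge0 => y _.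
    by rewrite mulr_ge0 ?sqr_ge0// ltW// reversible_weight_gt0//; exact: ratios_gt0.
  - by apply/measurable_EFinP; exact: measurable_green_sum.
  - apply/measurable_EFinP; apply: measurable_funM => //.
    by apply: measurable_funD => //; exact: measurable_sum.
  - move=> w _; rewrite lee_fin; apply: green_sum_le_green_term.
    exact: ratios_gt0.
have sum_ge0 w : (0 <= \sum_(1 <= x < N.+1) tm x w)%R by exact: sumr_ge0.
have msum : measurable_fun setT (fun w => \sum_(1 <= x < N.+1) tm x w)%R.
  exact: measurable_sum.
rewrite ge0_integralZl//; last 2 first.
- apply/measurable_EFinP; exact: measurable_funD.
- by move=> w _; rewrite lee_fin addr_ge0.
rewrite lee_pmul2l// ge0_integralD//; last 2 first.
- by move=> w _; rewrite lee_fin.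
- exact/measurable_EFinP.
rewrite leeD// integral_cst// mul1e.
by rewrite -[leRHS](@probability_setT _ _ _ P).
Qed.

(** The bound 2 (1 + E[A_N]) is controlled by a geometric series. *)
Lemma expectation_green_sum_bounded : \int[P]_w (ratios w 0)%:E < 1 ->
  exists C : R, forall N, \int[P]_w (green_sum (ratios w) N)%:E <= C%:E.
Proof.
move=> m1; have m0 : 0 <= \int[P]_w (ratios w 0)%:E.
  by apply: integral_ge0 => w _; rewrite lee_fin ltW// ratios_gt0.
have mfin : \int[P]_w (ratios w 0)%:E \is a fin_num.
  by rewrite ge0_fin_numE// (lt_trans m1)// ltry.
pose m := fine (\int[P]_w (ratios w 0)%:E).
have mE : \int[P]_w (ratios w 0)%:E = m%:E by rewrite fineK.
have {}m0 : (0 <= m)%R by rewrite -lee_fin -mE.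
have {}m1 : (m < 1)%R by rewrite -lte_fin -mE.
exists (2 * (1 + (1 - m)^-1))%R => -[|N].
  under eq_integral do rewrite /green_sum big_geq//.
  rewrite integral0 lee_fin mulr_ge0// addr_ge0// invr_ge0 subr_ge0.
  exact: ltW.
apply: le_trans (expectation_green_sum_le N) _.
rewrite (expectation_scale iidP) mE.
under eq_bigr do rewrite -EFin_expe.
rewrite sumEFin -EFinD -EFinM lee_fin ler_pM2l// lerD2l.
rewrite -[leRHS]mul1r ler_pdivlMr ?subr_gt0// mulrC -opprB mulNr -subrX1.
by rewrite opprB gerBl exprn_ge0.
Qed.

End UpperBound.

(** * Renewal bound *)

Section Overshoot.
Local Open Scope ereal_scope.
Context {R : realType}.
Implicit Types (w : environment R).

Definition overshoots (kappa v : R) (s : nat -> R) :=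
  exists y, (1 <= rho_prod s y * v)%R /\ (rho_prod s y.+1 * v < kappa)%R.

(** At the first index x where Pi_x v < 1, the absence of an overshoot gives
kappa <= Pi_x v, while decay_scale bounds A_x. *)
Lemma green_term_lower_bound (eta kappa v : R) (s : nat -> R) :
  (forall x, 0 < s x)%R -> (0 < eta)%R -> (0 <= kappa)%R -> (1 <= v)%R ->
  decays eta s -> ~ overshoots kappa v s ->
  exists x, (v * (kappa / (decay_scale eta + 1) ^+ 2) <= green_term s x.+1 v)%R.
Proof.
move=> s0 eta0 k0 v1 ds os; have v0 : (0 < v)%R by rewrite (lt_le_trans ltr01).
have below : exists n, (rho_prod s n * v < 1)%R.
  (* From this n on, the decay exp (- eta n) compensates the factor v. *)
  pose n := (Num.truncn (ln v / eta)).+1; exists n.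
  rewrite -ltr_pdivlMr// div1r (le_lt_trans (ds n))//.
  rewrite -[ltRHS]lnK ?posrE ?invr_gt0// ltr_expR lnV ?posrE// ltrN2.
  by rewrite mulrC -ltr_pdivrMr// truncnS_gt.
case: (ex_minnP below) => -[|x]; first by rewrite rho_prod0 mul1r ltNge v1.
move=> x1 xmin; exists x.
have y1 : (1 <= rho_prod s x * v)%R.
  by rewrite leNgt; apply/negP => /xmin; rewrite ltnn.
have xk : (kappa <= rho_prod s x.+1 * v)%R.
  by rewrite leNgt; apply/negP => h; apply: os; exists x.
have P0 : (0 < rho_prod s x.+1)%R by exact: rho_prod_gt0.
have A0 : (0 <= scale s x.+1)%R by exact: scale_ge0.
have AD := scale_le_decay_scale eta0 x.+1 ds.
rewrite (_ : green_term s x.+1 v = v * ((rho_prod s x.+1 * v) /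
  (scale s x.+1 + rho_prod s x.+1 * v) ^+ 2))%R; last first.
  by rewrite /green_term; ring.
have u0 : (0 < rho_prod s x.+1 * v)%R by rewrite mulr_gt0.
rewrite ler_pM2l// ler_pM//.
  by rewrite invr_ge0 sqr_ge0.
rewrite lef_pV2 ?posrE ?exprn_gt0 ?ltr_pwDr//; last first.
  exact/ltW/decay_scale_gt0.
by rewrite ler_sqr ?nnegrE ?addr_ge0 ?lerD ?(ltW u0) ?(ltW x1)// ltW// decay_scale_gt0.
Qed.

Definition decaying (eta : R) : set (environment R) :=
  [set w | decays eta (ratios w)].

Lemma measurable_decaying eta : measurable (decaying eta).
Proof.
rewrite (_ : decaying eta = \bigcap_n
    [set w | (rho_prod (ratios w) n <= expR (- (eta * n%:R)))%R]).
  apply: bigcap_measurableType => n _; rewrite -[X in measurable X]setTI.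
  by apply: measurable_fun_le => //; exact: measurable_rho_prod.
by apply/seteqP; split=> w /= h n => [_|]; exact: h.
Qed.

Variable P : probability (environment R) R.
Hypothesis iidP : iid_environment P.

Section logarithm.
Hypothesis int_ln : P.-integrable setT (fun w => (ln (ratios w 0))%:E).

Lemma integrable_ln_ratios i : P.-integrable setT (fun w => (ln (ratios w i))%:E).
Proof.
have mln j : measurable_fun [set: environment R] (fun w => ln (ratios w j)).
  by apply: (measurableT_comp (@measurable_ln R)); exact: measurable_ratios.
apply/integrableP; split; first exact/measurable_EFinP.
have /integrableP[_] := int_ln.
rewrite -(expectation_shift iidP i%:Z (F := fun w => `|(ln (ratios w 0))%:E|))//.
by apply: measurableT_comp => //; exact/measurable_EFinP.
Qed.

(** Half of the drift is spent on the exponential rate; the other half leaves a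
negative mean for the maximal ergodic lemma. *)
Lemma decaying_gt0 : \int[P]_w (ln (ratios w 0))%:E < 0 ->
  exists2 eta : R, (0 < eta)%R & 0 < P (decaying eta).
Proof.
move=> neg.
have fin : \int[P]_w (ln (ratios w 0))%:E \is a fin_num.
  exact: integrable_fin_num.
pose mu := fine (\int[P]_w (ln (ratios w 0))%:E).
have muE : \int[P]_w (ln (ratios w 0))%:E = mu%:E by rewrite fineK.
have mu0 : (mu < 0)%R by rewrite -lte_fin -muE.
pose eta : R := (- mu / 2)%R; exists eta; first by rewrite divr_gt0// oppr_gt0.
pose f w : R := (ln (ratios w 0) + eta)%R.
have icst : P.-integrable setT (EFin \o cst eta).
  exact: finite_measure_integrable_cst.
have intf : P.-integrable setT (EFin \o f).
  have -> : EFin \o f = (fun w => (ln (ratios w 0))%:E + (EFin \o cst eta) w).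
    by apply/funext => w; rewrite /= EFinD.
  exact: integrableD.
have mf : measurable_fun [set: environment R] f.
  by apply/measurable_EFinP; have /integrableP[] := intf.
have fneg : \int[P]_w (f w)%:E < 0.
  under eq_integral do rewrite EFinD.
  rewrite integralD//= muE integral_cst//.
  rewrite [X in _ * X](_ : _ = 1); last exact: probability_setT.
  by rewrite mule1 -EFinD lte_fin /eta; lra.
have := positive_probability_nonpositive_sums (measurable_shift 1%R)
  (shift_law iidP 1%R) intf fneg.
set E := [set w | _] => PE; apply: (lt_le_trans PE).
have mE : measurable E.
  rewrite (_ : E = \bigcap_n [set w | (\sum_(i < n) f (iter i (shift 1) w) <= 0)%R]).
    apply: bigcap_measurableType => n _; rewrite -[X in measurable X]setTI.
    apply: measurable_fun_le => //; apply: measurable_sum => i.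
    apply: measurableT_comp; first exact: mf.
    elim: (i : nat) => [|k IH]; first exact: measurable_id.
    by apply: measurableT_comp => //; exact: measurable_shift.
  by apply/seteqP; split=> w /= h n => [_|]; exact: h.
rewrite -(shift_law iidP 1%R mE) le_measure//.
- by apply: mem_set; exact: measurable_shift_preimage.
- by apply: mem_set; exact: measurable_decaying.
move=> w /= h n.
have iterE k : iter k (shift 1) (shift 1 w) = shift k.+1%:Z w.
  elim: k => [|k IH] //=; rewrite IH; apply/funext => x; rewrite /shift.
  congr (w _); lia.
have {}h := h n.
rewrite -[leLHS]lnK ?posrE ?rho_prod_gt0//; last exact: ratios_gt0.
rewrite ler_expR -subr_le0 opprK (le_trans _ h)// {h}.
elim: n => [|n IH]; first by rewrite rho_prod0 ln1 mulr0 addr0 big_ord0.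
rewrite big_ord_recr/= rho_prodSr lnM ?posrE ?ratios_gt0 ?rho_prod_gt0//; last exact: ratios_gt0.
rewrite {2}/f iterE ratios_shift addn0 -natr1 mulrDr mulr1.
by rewrite addrACA lerD.
Qed.

End logarithm.

Section renewal.
Variables (eta : R) (eta_gt0 : (0 < eta)%R).

Let level v c y := [set w : environment R | (1 <= rho_prod (ratios w) y * v < c)%R].

Lemma measurable_level v c y : measurable (level v c y).
Proof.
have mP : measurable_fun [set: environment R] (fun w => rho_prod (ratios w) y * v)%R.
  by apply: measurable_funM => //; exact: measurable_rho_prod.
rewrite (_ : level v c y = [set w | (1 <= rho_prod (ratios w) y * v)%R] `&`
   ~` [set w | (c <= rho_prod (ratios w) y * v)%R]).
  apply: measurableI; last apply: measurableC.
    by rewrite -[X in measurable X]setTI; apply: measurable_fun_le.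
  by rewrite -[X in measurable X]setTI; apply: measurable_fun_le.
apply/seteqP; split=> w /=.
  by move=> /andP[h1 h2]; split=> //; apply/negP; rewrite -ltNge.
by move=> [h1 /negP h2]; apply/andP; split=> //; rewrite ltNge.
Qed.

(** An independent decaying future multiplies each probability by that of
decaying eta; the products are the probabilities of the events counted by
renewal_count. *)
Lemma renewal_bound n v c : (0 < v)%R -> (1 <= c)%R ->
  \sum_(y < n) P (level v c y) * P (decaying eta) <= (1 + ln c / eta)%:E.
Proof.
move=> v0 c1.
have mD := measurable_decaying eta.
have mL := measurable_level v c.
have mind (A : set (environment R)) : measurable A ->
    measurable_fun [set: environment R] (\1_A : _ -> R) by [].
have term y : P (level v c y) * P (decaying eta) =
    \int[P]_w (\1_(level v c y) w * \1_(decaying eta) (shift y%:Z w))%:E.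
  rewrite (expectation_past_future iidP (n := y)
    (H := fun w w' => (\1_(level v c y) w * \1_(decaying eta) w')%:E)).
  - under eq_integral => w _.
      under eq_integral do rewrite EFinM.
      rewrite ge0_integralZl//; last by apply/measurable_EFinP; exact: mind.
      rewrite integral_indic// setIT.
      over.
    rewrite ge0_integralZr//; last by apply/measurable_EFinP; exact: mind.
    by rewrite integral_indic// setIT.
  - apply/measurable_EFinP; apply: measurable_funM.
      exact: (measurableT_comp (mind _ (measurable_level v c y))).
    exact: (measurableT_comp (mind _ mD)).
  - by move=> w w'; rewrite lee_fin mulr_ge0.
  - move=> w1 w2 w' h; congr (_ * _)%:E; rewrite !indicE; congr (nat_of_bool _)%:R.
    have e : rho_prod (ratios w1) y = rho_prod (ratios w2) y.
      by apply: eq_rho_prod => i /andP[_ iy]; rewrite /ratios /env_at h.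
    by apply/idP/idP => /set_mem h'; apply: mem_set; move: h'; rewrite /level/= e.
  - move=> w w1 w2 h; congr (_ * _)%:E; rewrite !indicE; congr (nat_of_bool _)%:R.
    have e n' : rho_prod (ratios w1) n' = rho_prod (ratios w2) n'.
      by apply: eq_rho_prod => i /andP[i0 _]; rewrite /ratios /env_at h.
    by apply/idP/idP => /set_mem dw; apply: mem_set => m;
      [rewrite -e|rewrite e]; exact: dw.
under eq_bigr do rewrite term.
pose F (y : nat) w := (\1_(level v c y) w * \1_(decaying eta) (shift y%:Z w))%:E : \bar R.
have mF y : measurable_fun setT (F y).
  apply/measurable_EFinP; apply: measurable_funM; first exact: mind.
  by apply: measurableT_comp; [exact: mind|exact: measurable_shift].
have F0 y w : 0 <= F y w by rewrite lee_fin mulr_ge0.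
rewrite -(ge0_integral_sum P measurableT (f := fun y : 'I_n => F y))//.
apply: (@le_trans _ _ (\int[P]_w (cst (1 + ln c / eta)%:E w))).
  apply: ge0_le_integral => //.
  - by move=> w _; exact: sume_ge0.
  - exact: emeasurable_sum.
  move=> w _; rewrite sumEFin lee_fin.
  apply: le_trans (renewal_count eta_gt0 (ratios_gt0 w) n v0 c1).
  apply: ler_sum => y _; rewrite !indicE -natrM mulnb ler_nat.
  case: andP => // -[/set_mem h1 /set_mem h2]; rewrite asboolT//.
  by split=> //; rewrite -ratios_shift.
rewrite integral_cst// [X in _ * X](_ : _ = 1) ?mule1//.
exact: probability_setT.
Qed.

End renewal.

End Overshoot.

(** * Lower bound *)

Lemma nneseries_le_bound {R : realType} (u : nat -> \bar R) (C : \bar R) :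
  (forall n, 0 <= u n)%E -> (forall n, \sum_(i < n) u i <= C)%E ->
  (\sum_(i <oo) u i <= C)%E.
Proof.
move=> u0 uC; have cv : cvgn (fun n => \sum_(0 <= i < n) u i)%E.
  by apply: is_cvg_nneseries => n _ _; exact: u0.
by apply: (lime_le cv); apply: nearW => n; rewrite big_mkord.
Qed.

Section LowerBound.
Local Open Scope ereal_scope.
Context {R : realType}.
Implicit Types (w : environment R).
Variable P : probability (environment R) R.
Hypothesis iidP : iid_environment P.

Section overshoot.
Variables (eta : R) (eta_gt0 : (0 < eta)%R).
Hypothesis int_ln : P.-integrable setT (fun w => (ln (ratios w 0))%:E).

(** Bound of renewal_bound for the interval [1, exp (- k) / r[, where r is the next
ratio: a jump from above 1 to below exp (- k) has to start in that interval. *)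
Let excess (k : nat) w : R :=
  (if 0 <= - k%:R - ln (ratios w 1) then 1 + (- k%:R - ln (ratios w 1)) / eta
   else 0)%R.

Let mln : measurable_fun [set: environment R] (fun w => ln (ratios w 1)).
Proof.
by apply: (measurableT_comp (@measurable_ln R)); exact: measurable_ratios.
Qed.

Let mexcess k : measurable_fun [set: environment R] (excess k).
Proof.
have ml : measurable_fun [set: environment R]
    (fun w => - k%:R - ln (ratios w 1))%R by exact: measurable_funB.
apply: measurable_fun_ifT => //; first exact: measurable_fun_ler.
by apply: measurable_funD => //; exact: measurable_funM.
Qed.

Let excess_ge0 k w : (0 <= excess k w)%R.
Proof.
by rewrite /excess; case: ifPn => // h; rewrite addr_ge0// divr_ge0// ltW.
Qed.

Let excess_small (e : R) : (0 < e)%R ->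
  exists k, \int[P]_w (excess k w)%:E <= e%:E.
Proof.
move=> e0.
have i1 := integrable_ln_ratios iidP int_ln 1.
pose g w : \bar R := 1 + (eta^-1)%:E * `|(ln (ratios w 1))%:E|.
have ig : P.-integrable setT g.
  apply: integrableD => //; first exact: (finite_measure_integrable_cst P 1%R).
  apply: integrableZl => //; exact: integrable_abse.
have cv : \int[P]_w (excess k w)%:E @[k --> \oo] --> \int[P]_w (cst 0 w : \bar R).
  apply: (@dominated_cvg _ _ _ P setT measurableT
    (fun k w => (excess k w)%:E) (cst 0) g) => //.
  - by move=> k; exact/measurable_EFinP.
  - move=> w _; apply: cvg_near_cst; near=> k.
    rewrite /excess ifN// -ltNge subr_lt0 ltrNl.
    near: k; exact: nbhs_infty_gtr.
  - move=> k w _; rewrite /g !abse_EFin [in leLHS]ger0_norm// -EFinM -EFinD lee_fin.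
    rewrite /excess; case: ifPn => h; last by rewrite addr_ge0// mulr_ge0// invr_ge0 ltW.
    rewrite lerD2l mulrC ler_wpM2l ?invr_ge0 ?(ltW eta_gt0)//.
    rewrite -normrN (le_trans _ (ler_norm _))// gerDr oppr_le0 ler0n//.
rewrite integral0 in cv.
apply: contrapT => h; have : e%:E <= 0.
  rewrite -(cvg_lim _ cv)//; apply: lime_ge; first exact: cvgP cv.
  apply: nearW => k; rewrite leNgt; apply/negP => /ltW hk; apply: h; by exists k.
by rewrite lee_fin leNgt e0.
Unshelve. all: by end_near.
Qed.

Let jump v kappa y := [set w : environment R |
  (1 <= rho_prod (ratios w) y * v)%R /\ (rho_prod (ratios w) y.+1 * v < kappa)%R].

Let measurable_jump v kappa y : measurable (jump v kappa y).
Proof.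
have mP n : measurable_fun [set: environment R] (fun w => rho_prod (ratios w) n * v)%R.
  by apply: measurable_funM => //; exact: measurable_rho_prod.
rewrite (_ : jump v kappa y = [set w | (1 <= rho_prod (ratios w) y * v)%R] `&`
   ~` [set w | (kappa <= rho_prod (ratios w) y.+1 * v)%R]).
  apply: measurableI; last apply: measurableC.
    by rewrite -[X in measurable X]setTI; apply: measurable_fun_le.
  by rewrite -[X in measurable X]setTI; apply: measurable_fun_le.
apply/seteqP; split=> w /=.
  by move=> [h1 h2]; split=> //; apply/negP; rewrite -ltNge.
by move=> [h1 /negP h2]; split=> //; rewrite ltNge.
Qed.

Let jump_pair v kappa y w w' : R :=
  (if (1 <= rho_prod (ratios w) y * v) &&
      (rho_prod (ratios w) y * v < kappa / ratios w' 1) then 1 else 0)%R.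

Let measurable_jump_pair v kappa y : measurable_fun setT
  (fun z : environment R * environment R => jump_pair v kappa y z.1 z.2).
Proof.
have m1 : measurable_fun setT (fun z : environment R * environment R =>
    rho_prod (ratios z.1) y * v)%R.
  apply: measurable_funM => //.
  exact: (measurableT_comp (measurable_rho_prod _)).
have m2 : measurable_fun setT (fun z : environment R * environment R =>
    kappa / ratios z.2 1)%R.
  apply: measurable_funM => //; apply: measurable_funV_gt0.
    by move=> z; exact: ratios_gt0.
  exact: (measurableT_comp (measurable_ratios _)).
apply: measurable_fun_ifT => //; apply: measurable_and.
  exact: measurable_fun_ler.
exact: measurable_fun_ltr.
Qed.

Let probability_jump v kappa y :
  P (jump v kappa y) = \int[P]_w' \int[P]_w (jump_pair v kappa y w w')%:E.
Proof.
have mJ := measurable_jump_pair v kappa y.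
have J0 w w' : 0 <= (jump_pair v kappa y w w')%:E.
  by rewrite lee_fin /jump_pair; case: ifP.
rewrite -(fubini_tonelli (fun z => (jump_pair v kappa y z.1 z.2)%:E))//;
  last exact/measurable_EFinP.
rewrite -(expectation_past_future iidP (n := y)
  (H := fun w w' => (jump_pair v kappa y w w')%:E))//.
- transitivity (\int[P]_w (\1_(jump v kappa y) w)%:E).
    by rewrite integral_indic ?setIT.
  apply: eq_integral => w _; rewrite indicE /jump_pair ratios_shift addn1.
  rewrite ltr_pdivlMr ?ratios_gt0//.
  have e : (rho_prod (ratios w) y.+1 * v = rho_prod (ratios w) y * v * ratios w y.+1)%R.
    by rewrite rho_prodSr mulrAC.
  rewrite -e; case: ifPn => [/andP[h1 h2]|h].
    by rewrite mem_set.
  rewrite memNset// => -[h1 h2]; move/negP: h; apply; exact/andP.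
- exact/measurable_EFinP.
- move=> w1 w2 w' h; rewrite /jump_pair (eq_rho_prod (s' := ratios w2))//.
  by move=> i /andP[_ iy]; rewrite /ratios /env_at h.
- by move=> w w1 w2 h; rewrite /jump_pair /ratios /env_at h.
Qed.

(** The ratio that makes the jump is independent of the product before the jump, so
that renewal_bound applies for each of its values. *)
Let sum_jump_le v k n : (0 < v)%R ->
  \sum_(y < n) P (jump v (expR (- k%:R)) y) * P (decaying eta) <=
  \int[P]_w (excess k w)%:E.
Proof.
move=> v0; pose kappa : R := expR (- k%:R).
pose F (y : nat) w' := \int[P]_w (jump_pair v kappa y w w')%:E.
have J0 y w w' : 0 <= (jump_pair v kappa y w w')%:E.
  by rewrite lee_fin /jump_pair; case: ifP.
have F0 y w : 0 <= F y w by exact: integral_ge0.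
have mF y : measurable_fun setT (F y).
  apply: (@measurable_fun_fubini_tonelli_G _ _ _ _ _ P
    (fun z => (jump_pair v kappa y z.1 z.2)%:E)) => //.
  by apply/measurable_EFinP; exact: measurable_jump_pair.
under eq_bigr do rewrite probability_jump -/kappa.
rewrite -ge0_sume_distrl//; last by move=> y _; apply: integral_ge0 => w _; exact: F0.
rewrite -(ge0_integral_sum P measurableT (f := fun y : 'I_n => F y))//.
rewrite -ge0_integralZr//; last 2 first.
- exact: emeasurable_sum.
- by move=> w _; exact: sume_ge0.
apply: ge0_le_integral => //.
- by move=> w _; rewrite mule_ge0// sume_ge0.
- by apply: emeasurable_funM => //; exact: emeasurable_sum.
- exact/measurable_EFinP.
move=> w' _.
have lnE : (- k%:R - ln (ratios w' 1) = ln (kappa / ratios w' 1))%R.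
  by rewrite lnM ?posrE ?expR_gt0 ?invr_gt0 ?ratios_gt0// lnV ?posrE ?ratios_gt0// /kappa expRK.
have c0 : (0 < kappa / ratios w' 1)%R by rewrite divr_gt0 ?expR_gt0 ?ratios_gt0.
rewrite /excess lnE.
have FE y : F y w' = P [set w | (1 <= rho_prod (ratios w) y * v < kappa / ratios w' 1)%R].
  transitivity (\int[P]_w (\1_[set w | (1 <= rho_prod (ratios w) y * v <
      kappa / ratios w' 1)%R] w)%:E); last first.
    by rewrite integral_indic ?setIT//; exact: measurable_level.
  apply: eq_integral => w _; rewrite /jump_pair indicE; case: ifPn => h.
    by rewrite mem_set.
  by rewrite memNset//; exact/negP.
case: ifPn => h.
  under eq_bigr do rewrite FE.
  rewrite ge0_sume_distrl//.
  apply: (renewal_bound iidP eta_gt0) => //.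
  by rewrite -[leLHS]expR0 -[leRHS]lnK ?posrE// ler_expR.
rewrite big1 ?mul0e// => y _; rewrite /F.
rewrite integral0_eq// => w _; rewrite /jump_pair ifF//; apply/negP => /andP[h1 h2].
move: h; rewrite -ltNge => h.
have := le_lt_trans h1 h2; rewrite -ltr_ln ?posrE// ln1 => h3.
by have := lt_trans h3 h; rewrite ltxx.
Qed.

Let overshootsE (v kappa : R) :
  [set w : environment R | overshoots kappa v (ratios w)] = \bigcup_y jump v kappa y.
Proof.
by apply/seteqP; split=> w /=; [move=> [y h]; exists y|move=> [y _ h]; exists y].
Qed.

Lemma measurable_overshoots (v kappa : R) :
  measurable [set w : environment R | overshoots kappa v (ratios w)].
Proof.
by rewrite overshootsE; apply: bigcupT_measurable => y; exact: measurable_jump.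
Qed.

(** As k grows, excess k tends to 0 and stays below an integrable function, because
the logarithm of the ratio is integrable. *)
Lemma overshoots_unlikely : 0 < P (decaying eta) ->
  exists2 kappa : R, (0 < kappa)%R & forall v, (0 < v)%R ->
    2%:E * P [set w | overshoots kappa v (ratios w)] <= P (decaying eta).
Proof.
move=> q0.
have mD := measurable_decaying eta.
have qfin : P (decaying eta) \is a fin_num by exact: fin_num_measure.
pose q := fine (P (decaying eta)).
have qE : P (decaying eta) = q%:E by rewrite fineK.
have {}q0 : (0 < q)%R by rewrite -lte_fin -qE.
(* One factor q is lost in sum_jump_le, the other one is the target q / 2. *)
have [k hk] := excess_small (divr_gt0 (mulr_gt0 q0 q0) (ltr0n R 2)).
exists (expR (- k%:R)); first exact: expR_gt0.
move=> v v0.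
have Pq : P [set w | overshoots (expR (- k%:R)) v (ratios w)] * q%:E <=
    (q * q / 2)%:E.
  apply: le_trans hk; rewrite -lee_pdivlMr//.
  apply: (@le_trans _ _ (\sum_(y <oo) P (jump v (expR (- k%:R)) y))).
    apply: measure_sigma_subadditive.
    - by move=> y; exact: measurable_jump.
    - exact: measurable_overshoots.
    - by rewrite overshootsE.
  apply: (nneseries_le_bound (u := fun y => P (jump v (expR (- k%:R)) y))) => // n.
  rewrite lee_pdivlMr// -qE ge0_sume_distrl//.
  exact: sum_jump_le.
have ofin : P [set w | overshoots (expR (- k%:R)) v (ratios w)] \is a fin_num.
  by apply: fin_num_measure; exact: measurable_overshoots.
move: Pq; rewrite qE -(fineK ofin) -!EFinM !lee_fin => h.
by rewrite -(ler_pM2r q0); lra.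
Qed.

End overshoot.

(** On the event that the ratios decay and do not overshoot the window below 1, one
summand is at least a constant multiple of v. *)
Lemma sum_green_term_ge : P.-integrable setT (fun w => (ln (ratios w 0))%:E) ->
  \int[P]_w (ln (ratios w 0))%:E < 0 ->
  exists2 c : R, (0 < c)%R & forall v, (1 <= v)%R ->
    (v * c)%:E <= \sum_(x <oo) \int[P]_w (green_term (ratios w) x.+1 v)%:E.
Proof.
move=> int_ln ln_neg.
have [eta eta0 q0] := decaying_gt0 iidP int_ln ln_neg.
have [kappa kappa0 hk] := overshoots_unlikely eta0 int_ln q0.
have mD := measurable_decaying eta.
have qfin : P (decaying eta) \is a fin_num by exact: fin_num_measure.
pose q := fine (P (decaying eta)).
have qE : P (decaying eta) = q%:E by rewrite fineK.
have {}q0 : (0 < q)%R by rewrite -lte_fin -qE.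
pose D := decay_scale eta.
have D0 : (0 < D)%R by exact: decay_scale_gt0.
pose c := (kappa / (D + 1) ^+ 2)%R.
have c0 : (0 < c)%R by rewrite divr_gt0// exprn_gt0// addr_gt0.
exists (c * (q / 2))%R; first by rewrite mulr_gt0// divr_gt0.
move=> v v1; have v0 : (0 < v)%R by rewrite (lt_le_trans ltr01).
have mgt x : measurable_fun setT (fun w => (green_term (ratios w) x v)%:E).
  apply/measurable_EFinP; apply: measurable_green_term => //.
  - by move=> w; exact: ratios_gt0.
  - exact: measurable_rho_prod.
  - exact: measurable_scale.
have gt0 x w : 0 <= (green_term (ratios w) x v)%:E.
  by rewrite lee_fin green_term_ge0//; exact: ratios_gt0.
rewrite -integral_nneseries//.
pose A := decaying eta `\` [set w | overshoots kappa v (ratios w)].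
have mO := measurable_overshoots v kappa.
have mA : measurable A by exact: measurableD.
have PA : (q / 2)%:E <= P A.
  have := hk v v0; rewrite qE => h.
  have ofin : P [set w | overshoots kappa v (ratios w)] \is a fin_num.
    exact: fin_num_measure.
  have : q%:E <= P A + P [set w | overshoots kappa v (ratios w)].
    rewrite -qE; apply: le_trans (measureU2 P mA mO).
    apply: le_measure; [exact: mem_set|by apply: mem_set; exact: measurableU|].
    by move=> w dw; have [ow|ow] := pselect (overshoots kappa v (ratios w)); [right|left].
  have Afin : P A \is a fin_num by exact: fin_num_measure.
  move: h; rewrite -(fineK ofin) -(fineK Afin) -EFinM -EFinD !lee_fin; lra.
apply: (@le_trans _ _ (\int[P]_w ((v * c)%:E * (\1_A w)%:E))).
  rewrite ge0_integralZl//; last by rewrite lee_fin mulr_ge0// ltW.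
  rewrite integral_indic// setIT mulrA EFinM lee_pmul2l// lte_fin mulr_gt0//.
  exact/measurable_EFinP.
apply: ge0_le_integral => //.
- by move=> w _; rewrite mule_ge0// lee_fin ltW// mulr_gt0.
- by apply: emeasurable_funM => //; exact/measurable_EFinP.
- exact: ge0_emeasurable_sum.
move=> w _; rewrite indicE; case: (boolP (w \in A)) => [/set_mem [dw ow]|_].
  rewrite mule1.
  have [x hx] := green_term_lower_bound (ratios_gt0 w) eta0 (ltW kappa0) v1 dw ow.
  apply: (@le_trans _ _ (green_term (ratios w) x.+1 v)%:E).
    by rewrite lee_fin.
  by rewrite (nneseriesD1 (n := x))// leeDl// nneseries_ge0.
by rewrite mule0 nneseries_ge0.
Qed.

(** For each M, the x-th summand is at least green_term x a with a the scale
function at M + 1 of the environment seen from x. Integrating over the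
independent past first, sum_green_term_ge leaves a multiple of the mean of a,
and that mean is at least M + 1. *)
Lemma expectation_green_sum_unbounded (C : \bar R) :
  P.-integrable setT (fun w => (ln (ratios w 0))%:E) ->
  \int[P]_w (ln (ratios w 0))%:E < 0 ->
  1 <= \int[P]_w (ratios w 0)%:E ->
  (forall N, \int[P]_w (green_sum (ratios w) N)%:E <= C) -> C = +oo.
Proof.
move=> int_ln ln_neg m1 hC.
have [c c0 hc] := sum_green_term_ge int_ln ln_neg.
have scale_gt0 n w : (0 < scale (ratios w) n.+1)%R.
  by rewrite (lt_le_trans ltr01)// scale_ge1//; exact: ratios_gt0.
suff lower M : (M.+1%:R * c)%:E <= C.
  apply/eqyP => B B0; apply: le_trans (lower (Num.truncn (B / c))).
  by rewrite lee_fin -ler_pdivrMr// ltW// truncnS_gt.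
pose a w := scale (ratios w) M.+1.
have a_gt0 w : (0 < a w)%R by exact: scale_gt0.
pose H x w w' := (green_term (ratios w) x.+1 (a w'))%:E.
have H0 x w w' : 0 <= H x w w'.
  by rewrite lee_fin green_term_ge0//; exact: ratios_gt0.
have mH x : measurable_fun setT (fun z : environment R * environment R => H x z.1 z.2).
  apply/measurable_EFinP; apply: measurable_green_term.
  - by move=> z; exact: ratios_gt0.
  - by move=> z; exact: a_gt0.
  - exact: (measurableT_comp (measurable_rho_prod _)).
  - exact: (measurableT_comp (measurable_scale _)).
  - exact: (measurableT_comp (measurable_scale _)).
pose phi x w' := \int[P]_w H x w w'.
have phi0 x w' : 0 <= phi x w' by exact: integral_ge0.
have mphi x : measurable_fun setT (phi x).
  exact: (@measurable_fun_fubini_tonelli_G _ _ _ _ _ P (fun z => H x z.1 z.2)).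
have phiE x : \int[P]_w' phi x w' =
    \int[P]_w (green_term (ratios w) x.+1 (scale (fun i => ratios w (x.+1 + i)%N) M.+1))%:E.
  rewrite -(fubini_tonelli (fun z => H x z.1 z.2))//.
  rewrite -(expectation_past_future iidP (n := x.+1) (H := H x))//.
  - by apply: eq_integral => w _; rewrite /H /a ratios_shift.
  - move=> w1 w2 w' h; rewrite /H /green_term.
    rewrite (eq_rho_prod (s' := ratios w2)); last first.
      by move=> i /andP[_ ix]; rewrite /ratios /env_at h.
    rewrite (eq_scale (s' := ratios w2))// => i /andP[_ ix].
    by rewrite /ratios /env_at h//; lia.
  - move=> w w1 w2 h; rewrite /H /a (eq_scale (s' := ratios w2))//.
    by move=> i /andP[i0 _]; rewrite /ratios /env_at h.
have le1 : \sum_(x <oo) \int[P]_w' phi x w' <= C.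
  apply: nneseries_le_bound => [x|n]; first exact: integral_ge0.
  apply: le_trans (hC (n + M.+1).+1).
  under eq_bigr do rewrite phiE.
  pose F (x : nat) w := (green_term (ratios w) x.+1
    (scale (fun i => ratios w (x.+1 + i)%N) M.+1))%:E.
  have F0 x w : 0 <= F x w by rewrite lee_fin green_term_ge0//; exact: ratios_gt0.
  have mF x : measurable_fun setT (F x).
    rewrite (_ : F x = fun w => H x w (shift x.+1%:Z w)); last first.
      by apply/funext => w; rewrite /F /H /a ratios_shift.
    exact: (measurableT_comp (mH x) (measurable_fun_pair (@measurable_id _ _ setT)
      (measurable_shift x.+1%:Z))).
  rewrite -(ge0_integral_sum P measurableT (f := fun x : 'I_n => F x))//.
  apply: ge0_le_integral => //.
  - by move=> w _; exact: sume_ge0.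
  - exact: emeasurable_sum.
  - by apply/measurable_EFinP; exact: measurable_green_sum.
  move=> w _; rewrite sumEFin lee_fin.
  apply: le_trans (green_term_le_green_sum (ratios_gt0 w) M.+1 n).
  by rewrite big_add1/= big_mkord.
apply: le_trans le1; rewrite -integral_nneseries//.
apply: (@le_trans _ _ (\int[P]_w' ((scale (ratios w') M.+1)%:E * c%:E))).
  rewrite ge0_integralZr//; last 3 first.
  - apply/measurable_EFinP; exact: measurable_scale.
  - by move=> w _; rewrite lee_fin ltW.
  - by rewrite lee_fin ltW.
  rewrite EFinM lee_pmul2r// (expectation_scale iidP).
  rewrite -[M.+1 in leLHS]card_ord -sum1_card natr_sum -sumEFin.
  apply: lee_sum => j _; elim: (j : nat) => [|k IH]; first by rewrite expe0.
  by rewrite expeS -[leLHS]mule1 lee_pmul.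
(* For a fixed second environment, the first one is integrated out. *)
apply: ge0_le_integral => //.
- by move=> w _; rewrite mule_ge0// lee_fin ltW.
- apply: emeasurable_funM => //; apply/measurable_EFinP; exact: measurable_scale.
- exact: ge0_emeasurable_sum.
move=> w' _; rewrite -EFinM; apply: hc.
by rewrite scale_ge1//; exact: ratios_gt0.
Qed.

End LowerBound.

(** * Return time under the averaged law *)

Section Annealed.
Local Open Scope ereal_scope.
Context {R : realType}.
Implicit Types (w : environment R).

Definition walk_probs w (i : nat) : R := env_at i%:Z w.

Lemma walk_probs_itv w i : (0 <= walk_probs w i <= 1)%R.
Proof. by rewrite /walk_probs /env_at ge0 le1. Qed.

Lemma measurable_first_hit n x :
  measurable_fun [set: environment R] (fun w => first_hit (walk_probs w) n x).
Proof.
elim: n x => [|n IH] [|x]; try exact: measurable_cst.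
have mo : measurable_fun [set: environment R] (fun w => walk_probs w x.+1).
  exact: measurable_env_at.
rewrite /=; apply: measurable_funD; apply: measurable_funM => //.
exact: measurable_funB.
Qed.

Definition elliptic w := forall i, (0 < walk_probs w i < 1)%R.

Lemma elliptic_ratios w i : elliptic w ->
  (ratios w i = (1 - walk_probs w i) / walk_probs w i)%R.
Proof. by move=> ew; rewrite /ratios /site_ratio -/(walk_probs w i) ew. Qed.

Definition excursion n := [set X : trajectory | [/\ X 1%N = 1%R,
  forall j, (j < n)%N -> X j.+1 != X 0%N & X n.+1 = X 0%N]].

Lemma measurable_return m : measurable [set X : trajectory | X m = X 0%N].
Proof.
rewrite (_ : [set X | _] = \bigcup_(k : int) ([set X : trajectory | X m = k] `&`
  [set X : trajectory | X 0%N = k])).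
  apply: countable_bigcupT_measurable; first exact: countableP.
  by move=> k; apply: measurableI; exact: measurable_position.
apply/seteqP; split=> X /=; first by move=> e; exists (X 0%N).
by move=> [k _ [-> ->]].
Qed.

Lemma measurable_excursion n : measurable (excursion n).
Proof.
rewrite (_ : excursion n = [set X : trajectory | X 1%N = 1%R] `&`
  \bigcap_(j in [set j | (j < n)%N]) ~` [set X : trajectory | X j.+1 = X 0%N] `&`
  [set X : trajectory | X n.+1 = X 0%N]).
  apply: measurableI; last exact: measurable_return.
  apply: measurableI; first exact: measurable_position.
  apply: bigcap_measurableType => j _; apply: measurableC.
  exact: measurable_return.
apply/seteqP; split=> X /=.
  by move=> [h1 h2 h3]; split=> //; split=> // j jn; exact/eqP/h2.
by move=> [[h1 h2] h3]; split=> // j jn; apply/eqP; exact: h2.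
Qed.

Lemma return_time_excursion n X : excursion n X ->
  return_time X = n.+1%:R%:E :> \bar R.
Proof.
move=> [X1 h1 h2]; apply/eqP; rewrite eq_le; apply/andP; split.
  by apply: ereal_inf_lbound; exists n.+1.
apply: le_ereal_inf_tmp => _ [[|m] [// _ Xm] <-].
rewrite lee_fin ler_nat ltnS leqNgt; apply/negP => mn.
by have := h1 m mn; rewrite Xm eqxx.
Qed.

Lemma return_finiteP X :
  (X 1%N = 1%R /\ return_time X < (+oo : \bar R)) <-> exists n, excursion n X.
Proof.
split; last by move=> [n hn]; rewrite (return_time_excursion hn) ltry; case: hn.
move=> [X1 fin].
have ex : exists n, X n.+1 == X 0%N.
  apply: contrapT => h; move: fin; rewrite /return_time (_ : [set _ | _ in _] = set0).
    by rewrite ereal_inf0 ltxx.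
  apply/seteqP; split=> // y [[|m] [// _ Xm] _]; apply: h; exists m; exact/eqP.
case: (ex_minnP ex) => n /eqP Xn nmin; exists n; split=> // j jn.
by apply/negP => /nmin; rewrite leqNgt jn.
Qed.

Let event := [set X : trajectory | X 1%N = 1%R /\ return_time X < (+oo : \bar R)].

Lemma return_time_series X : return_time X * (\1_event X)%:E =
  \sum_(n <oo) (n.+1%:R * \1_(excursion n) X)%:E :> \bar R.
Proof.
rewrite indicE; case: (boolP (X \in event)) => [/set_mem /return_finiteP[n hn]|hX].
  rewrite (return_time_excursion hn) mule1 (nneseriesD1 (n := n))//.
  rewrite indicE mem_set// mulr1 eseries0 ?adde0// => k _ /andP[_ kn].
  rewrite indicE memNset ?mulr0// => hk; have := return_time_excursion hk.
  rewrite (return_time_excursion hn) => -[] /eqP; rewrite eqr_nat eqSS => /eqP nk.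
  by rewrite nk eqxx in kn.
rewrite mule0 eseries0// => k _ _; rewrite indicE memNset ?mulr0// => hk.
move/negP : hX; apply; apply: mem_set; apply/return_finiteP; by exists k.
Qed.

Variables (P : probability (environment R) R)
  (Q : R.-pker (environment R) ~> trajectory).
Hypothesis quenchedQ : quenched_law Q.

Lemma quenched_excursion n w :
  Q w (excursion n) = (walk_probs w 0 * first_hit (walk_probs w) n 1)%:E.
Proof.
rewrite -[RHS](quenched_first_return quenchedQ w n).
have m0 := measurable_position 0 0%R.
have QT : Q w setT = 1 by exact: prob_kernel.
have [Q1 _] := quenchedQ w.
have Q0 : Q w (~` [set X : trajectory | X 0%N = 0%R]) = 0.
  rewrite -setTD measureD//; last first.
    by apply: (le_lt_trans _ (ltry 1)); rewrite -QT lexx.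
  rewrite setTI; apply: eq_trans (congr2 (fun a b => a - b) QT Q1) _.
  by rewrite subee.
have mE := measurable_excursion n.
have mE0 : measurable (excursion n `&` [set X : trajectory | X 0%N = 0%R]).
  exact: measurableI.
have mE1 : measurable (excursion n `&` ~` [set X : trajectory | X 0%N = 0%R]).
  by apply: measurableI => //; exact: measurableC.
rewrite (_ : [set X | _] = excursion n `&` [set X : trajectory | X 0%N = 0%R]).
  rewrite [X in Q w X = _](_ : excursion n = (excursion n `&` [set X : trajectory | X 0%N = 0%R])
    `|` (excursion n `&` ~` [set X : trajectory | X 0%N = 0%R])); last first.
    by rewrite -setIUr setUv setIT.
  rewrite measureU0//.
  apply: (@subset_measure0 _ _ _ (Q w) _ (~` [set X : trajectory | X 0%N = 0%R])) => //.
  exact: measurableC.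
apply/seteqP; split=> X /=.
  by move=> [X0 X1 h1 h2]; split=> //; split; rewrite ?X0.
by move=> [[X1 h1 h2] X0]; split=> //; rewrite -X0.
Qed.

Lemma averaged_excursion n : averaged_law P Q (excursion n) =
  \int[P]_w (walk_probs w 0 * first_hit (walk_probs w) n 1)%:E.
Proof. by apply: eq_integral => w _; exact: quenched_excursion. Qed.

Lemma integral_return_time :
  \int[averaged_law P Q]_X (return_time X * (\1_event X)%:E) =
  \sum_(n <oo) n.+1%:R%:E *
    \int[P]_w (walk_probs w 0 * first_hit (walk_probs w) n 1)%:E.
Proof.
rewrite (eq_integral (fun X => \sum_(n <oo) (n.+1%:R * \1_(excursion n) X)%:E)); last first.
  by move=> X _; exact: return_time_series.
have mi n : measurable_fun setT (fun X : trajectory => \1_(excursion n) X : R).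
  by apply: measurable_indic; exact: measurable_excursion.
have mi' n : measurable_fun setT (fun X : trajectory => (\1_(excursion n) X : R)%:E).
  exact/measurable_EFinP.
rewrite integral_nneseries//; last first.
  by move=> n; apply/measurable_EFinP; exact: measurable_funM.
apply: eq_eseriesr => n _.
under eq_integral do rewrite EFinM.
rewrite ge0_integralZl//.
rewrite integral_indic ?setIT//; last exact: measurable_excursion.
by rewrite -averaged_excursion.
Qed.

End Annealed.

Section ReturnMoment.
Local Open Scope ereal_scope.
Context {R : realType}.
Implicit Types (w : environment R).
Variable P : probability (environment R) R.
Hypothesis iidP : iid_environment P.

Let itv01P w (i : nat) : (0 < walk_probs w i < 1)%R -> rho i%:Z w = (ratios w i)%:E.
Proof.
move=> h; rewrite /rho /ratios /site_ratio -/(walk_probs w i) h.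
by rewrite inver gt_eqF//; case/andP: h.
Qed.

Lemma rho_elliptic w : elliptic w -> rho 0 w = (ratios w 0)%:E.
Proof. by move=> ew; exact: (itv01P (ew 0%N)). Qed.

Lemma lne_rho_elliptic w : elliptic w -> lne (rho 0 w) = (ln (ratios w 0))%:E.
Proof. by move=> ew; rewrite rho_elliptic//= ifF// leNgt ratios_gt0. Qed.

Lemma measurable_rho : measurable_fun setT (fun w => rho 0 w).
Proof.
pose g w := (if 0 < walk_probs w 0 then walk_probs w 0 else 1)%R.
have mo : measurable_fun [set: environment R] (fun w => walk_probs w 0).
  exact: measurable_env_at.
rewrite (_ : (fun w => rho 0 w) = fun w => if (0 < walk_probs w 0)%R then
   ((1 - walk_probs w 0) * (g w)^-1)%:E else +oo); last first.
  apply/funext => w; rewrite /rho /g -/(walk_probs w 0); case: ifPn => h.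
    by rewrite inver gt_eqF// h.
  have -> : walk_probs w 0 = 0%R.
    by apply/eqP; rewrite eq_le leNgt h; case/andP: (walk_probs_itv w 0).
  by rewrite subr0 inver eqxx mul1e.
apply: measurable_fun_ifT => //; first exact: measurable_fun_ltr.
apply/measurable_EFinP; apply: measurable_funM; first exact: measurable_funB.
apply: measurable_funV_gt0; first by move=> w; rewrite /g; case: ifP.
by apply: measurable_fun_ifT => //; exact: measurable_fun_ltr.
Qed.

Hypothesis int_lne : P.-integrable setT (fun w => lne (rho 0 w)).

(** The extended logarithm of rho is infinite at the two endpoints of the unit
interval. *)
Lemma ae_elliptic : \forall w \ae P, elliptic w.
Proof.
pose B : set R := ~` [set` `]0%R, 1%R[].
have mB : measurable B by apply: measurableC.
have mpre i : measurable (env_at i @^-1` B).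
  by rewrite -[X in measurable X]setTI; exact: measurable_env_at.
have P0 : P (env_at 0%R @^-1` B) = 0.
  apply/negligibleP => //.
  have [N [mN PN sN]] := integrable_ae measurableT int_lne.
  exists N; split=> // w /= wB; apply: sN => /= fin; apply: wB.
  have {}fin := fin I.
  rewrite /= in_itv/=; apply: contrapT => h; move: fin.
  have /andP[] := walk_probs_itv w 0.
  rewrite le_eqVlt => /predU1P[z0 _ | p0].
    have -> : rho 0 w = +oo.
      by rewrite /rho -[env_at _ _]z0 subr0 inve0 mul1e.
    by [].
  rewrite le_eqVlt => /predU1P[z1 | p1].
    have -> : rho 0 w = 0 by rewrite /rho -[env_at _ _]/(walk_probs w 0) z1 subrr mul0e.
    by rewrite le0_lneNy.
  by move: h; rewrite -[env_at _ _]/(walk_probs w 0) p0 p1.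
apply: ae_foralln => i; exists (env_at i%:Z @^-1` B); split=> //.
  exact: (eq_trans (iidP.1 i%:Z 0%R B mB) P0).
Qed.

Lemma integral_rho : \int[P]_w rho 0 w = \int[P]_w (ratios w 0)%:E.
Proof.
apply: ae_eq_integral => //.
- exact: measurable_rho.
- by apply/measurable_EFinP; exact: measurable_ratios.
by apply: filterS ae_elliptic => w ew _; exact: rho_elliptic.
Qed.

Let mln : measurable_fun setT (fun w => (ln (ratios w 0))%:E).
Proof.
apply/measurable_EFinP.
by apply: (measurableT_comp (@measurable_ln R)); exact: measurable_ratios.
Qed.

Lemma integral_lne_rho :
  \int[P]_w lne (rho 0 w) = \int[P]_w (ln (ratios w 0))%:E.
Proof.
apply: ae_eq_integral => //; first by have /integrableP[] := int_lne.
by apply: filterS ae_elliptic => w ew _; exact: lne_rho_elliptic.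
Qed.

Lemma integrable_ln_ratio : P.-integrable setT (fun w => (ln (ratios w 0))%:E).
Proof.
apply/integrableP; split => //; have /integrableP[ml] := int_lne.
rewrite (ae_eq_integral (fun w => `|(ln (ratios w 0))%:E|))//.
- exact: measurableT_comp.
- exact: measurableT_comp.
by apply: filterS ae_elliptic => w ew _; rewrite lne_rho_elliptic.
Qed.

Lemma integral_gt0 (f : environment R -> R) : measurable_fun setT f ->
  (forall w, 0 <= f w)%R -> (forall w, elliptic w -> 0 < f w)%R ->
  0 < \int[P]_w (f w)%:E.
Proof.
move=> mf f0 fe; rewrite lt0e integral_ge0 ?andbT//; last first.
  by move=> w _; rewrite lee_fin.
apply/eqP => I0.
have : ae_eq P setT (EFin \o f) (cst 0).
  apply/ae_eq_integral_abs => //; first exact/measurable_EFinP.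
  rewrite -[RHS]I0; apply: eq_integral => w _.
  by rewrite /= ger0_norm.
move=> /(filterI ae_elliptic) [N [mN PN sN]].
have : P setT = 0.
  apply/eqP; rewrite eq_le measure_ge0 andbT -PN le_measure ?inE//.
  move=> w _; apply: sN => -[ew /(_ I) [] fw0].
  by have := fe w ew; rewrite fw0 ltxx.
by rewrite probability_setT => /eqP; rewrite onee_eq0.
Qed.

Let o w := walk_probs w.

Let f_ge0 w n : (0 <= first_hit (o w) n 1)%R.
Proof. by apply: first_hit_ge0; exact: walk_probs_itv. Qed.

Let mf n : measurable_fun setT (fun w => first_hit (o w) n 1).
Proof. exact: measurable_first_hit. Qed.

Let mo i : measurable_fun setT (fun w => o w i).
Proof. exact: measurable_env_at. Qed.

Lemma return_series_bounded (C : R) :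
  (forall N, \int[P]_w (green_sum (ratios w) N)%:E <= C%:E) ->
  \sum_(n <oo) n.+1%:R%:E * \int[P]_w (o w 0 * first_hit (o w) n 1)%:E <= (C + 1)%:E.
Proof.
move=> hC; apply: nneseries_le_bound => [n|K].
  rewrite mule_ge0//; apply: integral_ge0 => w _.
  by rewrite lee_fin mulr_ge0//; case/andP: (walk_probs_itv w 0).
pose F n w := (n.+1%:R * (o w 0 * first_hit (o w) n 1))%R.
have F0 n w : (0 <= F n w)%R.
  by rewrite !mulr_ge0//; case/andP: (walk_probs_itv w 0).
have mF n : measurable_fun setT (F n).
  by apply: measurable_funM => //; exact: measurable_funM.
have -> : \sum_(n < K) n.+1%:R%:E * \int[P]_w (o w 0 * first_hit (o w) n 1)%:E =
    \int[P]_w (\sum_(n < K) (F n w)%:E).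
  rewrite (ge0_integral_sum P measurableT (f := fun (n : 'I_K) w => (F n w)%:E))//.
  - apply: eq_bigr => n _; rewrite -ge0_integralZl//.
    + by apply/measurable_EFinP; exact: measurable_funM.
    + by move=> w _; rewrite lee_fin mulr_ge0//; case/andP: (walk_probs_itv w 0).
  - by move=> n; exact/measurable_EFinP.
  - by move=> n w _; rewrite lee_fin.
have gs0 w N : (0 <= green_sum (ratios w) N)%R.
  apply: sumr_ge0 => y _; rewrite mulr_ge0 ?sqr_ge0// ltW//.
  by apply: reversible_weight_gt0; exact: ratios_gt0.
apply: (@le_trans _ _ (\int[P]_w ((green_sum (ratios w) K.+1)%:E + cst 1%:E w))).
  apply: ae_ge0_le_integral => //.
  - by move=> w _; apply: sume_ge0 => n _; rewrite lee_fin.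
  - by apply: emeasurable_sum => n; exact/measurable_EFinP.
  - by move=> w _; rewrite -EFinD lee_fin addr_ge0.
  - by apply/measurable_EFinP; apply: measurable_funD => //; exact: measurable_green_sum.
  apply: filterS ae_elliptic => w ew _.
  rewrite sumEFin -EFinD lee_fin.
  have oe x : (0 < o w x)%R by case/andP: (ew x).
  have oe1 x : (o w x < 1)%R by case/andP: (ew x).
  have sE x : (ratios w x = (1 - o w x) / o w x)%R by exact: elliptic_ratios.
  apply: (@le_trans _ _ (moment (o w) K 1 + mass (o w) K 1)%R).
    rewrite -big_split/=; apply: ler_sum => n _; rewrite /F -natr1 mulrDl mul1r.
    rewrite lerD// ?ler_wpM2l// ler_piMl// ?(ltW (oe1 _))//.
  by rewrite lerD ?(moment_le_green_sum oe oe1 sE) ?(mass_le1 oe oe1 sE).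
rewrite ge0_integralD//; last 2 first.
- by move=> w _; rewrite lee_fin.
- by apply/measurable_EFinP; exact: measurable_green_sum.
rewrite EFinD leeD// integral_cst// mul1e.
by rewrite -[leRHS](@probability_setT _ _ _ P).
Qed.

(** The jump from 0 to 1 depends on the site 0, which first_hit from 1 never sees;
the series is thus at least the positive mean of omega_0 times the mean of T,
and the latter dominates the mean of every green_sum. *)
Lemma return_series_infinite :
  \int[P]_w lne (rho 0 w) < 0 -> 1 <= \int[P]_w (ratios w 0)%:E ->
  \sum_(n <oo) n.+1%:R%:E * \int[P]_w (o w 0 * first_hit (o w) n 1)%:E = +oo.
Proof.
rewrite integral_lne_rho => neg m1.
pose e0 := \int[P]_w (o w 0)%:E.
have e0_gt0 : 0 < e0.
  apply: integral_gt0 => //.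
    by move=> w; case/andP: (walk_probs_itv w 0).
  by move=> w ew; case/andP: (ew 0%N).
have e0_fin : e0 \is a fin_num.
  rewrite ge0_fin_numE ?(ltW e0_gt0)// (@le_lt_trans _ _ (\int[P]_w cst 1 w))//.
    apply: ge0_le_integral => //; last by move=> w _; rewrite lee_fin; case/andP: (walk_probs_itv w 0).
    - by move=> w _; rewrite lee_fin; case/andP: (walk_probs_itv w 0).
    - exact/measurable_EFinP.
  rewrite integral_cst// mul1e (@le_lt_trans _ _ 1) ?ltry//.
  by rewrite -[leRHS](@probability_setT _ _ _ P).
pose F n w := (n%:R * first_hit (o w) n 1)%:E.
have F0 n w : 0 <= F n w by rewrite lee_fin mulr_ge0.
have mF n : measurable_fun setT (F n).
  by apply/measurable_EFinP; exact: measurable_funM.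
have indep n : \int[P]_w (o w 0 * first_hit (o w) n 1)%:E =
    e0 * \int[P]_w (first_hit (o w) n 1)%:E.
  have shift0 w : shift 0%:Z w = w by apply/funext => x; rewrite /shift addr0.
  transitivity (\int[P]_w \int[P]_w' ((o w 0)%:E * (first_hit (o w') n 1)%:E)).
    rewrite -(expectation_past_future iidP (n := 0)
      (H := fun w w' => (o w 0)%:E * (first_hit (o w') n 1)%:E)).
    - by apply: eq_integral => w _; rewrite shift0 EFinM.
    - apply: emeasurable_funM; apply/measurable_EFinP.
        exact: (measurableT_comp (mo 0)).
      exact: (measurableT_comp (mf n)).
    - by move=> w w'; rewrite mule_ge0// lee_fin//; case/andP: (walk_probs_itv w 0).
    - by move=> w1 w2 w' h; rewrite /o /walk_probs /env_at h.
    - move=> w w1 w2 h; congr (_ * _%:E); apply: eq_first_hit => i i0.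
      by rewrite /o /walk_probs /env_at h.
  under eq_integral => w _.
    rewrite ge0_integralZl//; last 3 first.
    - exact/measurable_EFinP.
    - by move=> w' _; rewrite lee_fin.
    - by rewrite lee_fin; case/andP: (walk_probs_itv w 0).
    over.
  rewrite ge0_integralZr//.
  - exact/measurable_EFinP.
  - by move=> w _; rewrite lee_fin; case/andP: (walk_probs_itv w 0).
  - by apply: integral_ge0 => w _; rewrite lee_fin.
have Finf : \int[P]_w (\sum_(n <oo) F n w) = +oo.
  apply: (expectation_green_sum_unbounded iidP integrable_ln_ratio neg m1) => N.
  apply: ae_ge0_le_integral => //.
  - move=> w _; rewrite lee_fin; apply: sumr_ge0 => y _.
    rewrite mulr_ge0 ?sqr_ge0// ltW//.
    by apply: reversible_weight_gt0; exact: ratios_gt0.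
  - by apply/measurable_EFinP; exact: measurable_green_sum.
  - by move=> w _; exact: nneseries_ge0.
  - exact: ge0_emeasurable_sum.
  apply: filterS ae_elliptic => w ew _.
  have oe x : (0 < o w x)%R by case/andP: (ew x).
  have oe1 x : (o w x < 1)%R by case/andP: (ew x).
  have sE x : (ratios w x = (1 - o w x) / o w x)%R by exact: elliptic_ratios.
  have S0 : 0 <= \sum_(n <oo) F n w by exact: nneseries_ge0.
  case SE : (\sum_(n <oo) F n w) S0 => [S| |] // S0; last by rewrite leey.
  rewrite lee_fin; case: N => [|N].
    by rewrite /green_sum big_geq.
  apply: (green_sum_le_moment oe oe1 sE) => // K.
  rewrite -lee_fin -SE /moment -sumEFin.
  by rewrite -(big_mkord xpredT (F^~ w)) nneseries_lim_ge.
apply/eqP; rewrite -leye_eq.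
apply: (@le_trans _ _ (e0 * \int[P]_w (\sum_(n <oo) F n w))).
  by rewrite Finf gt0_muley.
rewrite integral_nneseries// -[X in X * _](fineK e0_fin) -nneseriesZl; last first.
  by move=> n _; exact: integral_ge0.
rewrite fineK//.
apply: lee_nneseries => [n _ _|n _].
  by rewrite mule_ge0 ?(ltW e0_gt0)//; exact: integral_ge0.
have f0 : 0 <= \int[P]_w (first_hit (o w) n 1)%:E.
  by apply: integral_ge0 => w _; rewrite lee_fin.
rewrite indep muleCA lee_wpmul2l ?(ltW e0_gt0)//.
rewrite /F; under eq_integral do rewrite EFinM.
rewrite ge0_integralZl//.
- by rewrite lee_wpmul2r// lee_fin ler_nat.
- exact/measurable_EFinP.
- by move=> w _; rewrite lee_fin.
Qed.

End ReturnMoment.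

Local Open Scope ereal_scope.

Theorem theorem1p4 (R : realType) (P : probability (environment R) R)
    (Q : R.-pker (environment R) ~> trajectory) :
  quenched_law Q ->
  iid_environment P ->
  P.-integrable [set: environment R] (fun w => lne (rho 0%R w)) ->
  -oo < \int[P]_w lne (rho 0%R w) < 0 ->
  (\int[P]_w rho 0%R w < 1 ->
     cond_expectation (averaged_law P Q) return_time
       [set X | X 1%N = 1%R /\ return_time X < (+oo : \bar R)] < +oo) /\
  (1 < \int[P]_w rho 0%R w \/
   (\int[P]_w rho 0%R w = 1 /\
    \int[P]_w (rho 0%R w * lne (rho 0%R w)) < +oo) ->
     cond_expectation (averaged_law P Q) return_time
       [set X | X 1%N = 1%R /\ return_time X < (+oo : \bar R)] = +oo).
Proof.
move=> quenchedQ iidP int_lne /andP[_ lne_neg].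
set A := [set X : trajectory | _].
have AE : A = \bigcup_n excursion n.
  apply/seteqP; split=> X; first by move=> /return_finiteP[n hn]; exists n.
  by move=> [n _ hn]; apply/(return_finiteP (R := R)); exists n.
have mA : measurable A.
  by rewrite AE; apply: bigcupT_measurable => n; exact: measurable_excursion.
have A_gt0 : 0 < averaged_law P Q A.
  apply: (@lt_le_trans _ _ (averaged_law P Q (excursion 1))); last first.
    apply: le_measure; [apply: mem_set; exact: measurable_excursion|exact: mem_set|].
    by rewrite AE; exact: bigcup_sup.
  rewrite (averaged_excursion P quenchedQ); apply: (integral_gt0 iidP int_lne).
  - apply: measurable_funM; first exact: measurable_env_at.
    exact: measurable_first_hit.
  - move=> w; rewrite mulr_ge0//; first by case/andP: (walk_probs_itv w 0).
    by apply: first_hit_ge0; exact: walk_probs_itv.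
  - move=> w ew; rewrite /= mulr0 add0r mulr1 mulr_gt0//.
      by case/andP: (ew 0%N).
    by rewrite subr_gt0; case/andP: (ew 1%N).
have A_fin : averaged_law P Q A \is a fin_num by exact: fin_num_measure.
pose a := fine (averaged_law P Q A).
have aE : averaged_law P Q A = a%:E by rewrite fineK.
have a0 : (0 < a)%R by rewrite -lte_fin -aE.
rewrite /cond_expectation (integral_return_time P quenchedQ).
rewrite [X in _ / X](_ : _ = a%:E)// inver gt_eqF//.
rewrite !(integral_rho iidP int_lne); split=> [m1|m1].
  have [C hC] := expectation_green_sum_bounded iidP m1.
  have := return_series_bounded iidP int_lne hC.
  set S := \sum_(_ <oo) _ => SC.
  have S0 : 0 <= S.
    apply: nneseries_ge0 => n _ _; rewrite mule_ge0//; apply: integral_ge0 => w _.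
    rewrite lee_fin mulr_ge0//; first by case/andP: (walk_probs_itv w 0).
    by apply: first_hit_ge0; exact: walk_probs_itv.
  have Sfin : S \is a fin_num by rewrite ge0_fin_numE// (le_lt_trans SC)// ltry.
  by rewrite -(fineK Sfin) -EFinM ltry.
rewrite (return_series_infinite iidP int_lne lne_neg).
  by rewrite gt0_mulye// lte_fin invr_gt0.
by case: m1 => [/ltW//|[-> _]].
Qed.
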